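(* Let $H$ be an infinite dimensional complex Hilbert space and let $\mathcal{V} \subseteq \mathcal{B}(H)$ be an operator system. Then $\mathcal{V}$ has either an infinite quantum clique or an infinite quantum almost anticlique (i.e. at least one of these exists).
   Context: $\mathcal{B}(H)$ is the space of bounded linear operators on $H$. An operator system is a (not necessarily closed) linear subspace $\mathcal{V} \subseteq \mathcal{B}(H)$ containing the identity $I_H$ and closed under adjoints. Projections are orthogonal projections. The weak topology on $\mathcal{B}(H)$ is the weak operator topology. For a projection $P$, the compression of $\mathcal{V}$ is $P\mathcal{V}P = \{PAP : A \in \mathcal{V}\}$. An infinite quantum clique of $\mathcal{V}$ is an infinite rank projection $P \in \mathcal{B}(H)$ such that $P\mathcal{V}P$ is weakly dense in $P\mathcal{B}(H)P$. An infinite quantum almost anticlique of $\mathcal{V}$ is an infinite rank projection $P \in \mathcal{B}(H)$ such that $P\mathcal{V}P$ is finite dimensional and every operator in $P\mathcal{V}P$ can be written as the sum of a scalar multiple of $P$ and a compact operator. *)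

(* Defs.v *)
From mathcomp Require Import all_boot all_order all_algebra sesquilinear.
From mathcomp Require Import complex.
From mathcomp Require Import all_classical all_reals.
From mathcomp Require Import topology normedtype.

Set Implicit Arguments.
Unset Strict Implicit.
Unset Printing Implicit Defensive.

Import Order.TTheory GRing.Theory Num.Theory.
Import numFieldNormedType.Exports.

Local Open Scope classical_set_scope.
Local Open Scope ring_scope.
Local Open Scope complex_scope.

(** Meant for linear subspaces [A]. *)
Definition finite_dimensional (K : fieldType) (V : lmodType K) (A : set V) :=
  exists (n : nat) (e : 'I_n -> V), (forall i, A (e i)) /\
    (forall v, A v -> exists c : 'I_n -> K, v = \sum_(i < n) c i *: e i).

Section Operators.
Variables (R : realType) (H : completeNormedModType R[i]).
Variable dot : {dot H for (@Num.conj R[i])}.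

(** Operators are plain functions [H -> H], with their pointwise vector space
    structure; [bounded_operators] carves out B(H). *)
Definition bounded_operators : set (H -> H) :=
  [set A | linear A /\ exists M : R[i], forall x, `|A x| <= M * `|x|].

(** Bounded operators on a Hilbert space have exactly one adjoint. *)
Definition is_adjoint (A B : H -> H) :=
  forall x y, dot (A x) y = dot x (B y).

Definition operator_system (V : set (H -> H)) :=
  [/\ V `<=` bounded_operators,
      V idfun,
      forall (a : R[i]) A B, V A -> V B -> V (a *: A + B) &
      forall A, V A -> exists2 B, V B & is_adjoint A B].

Definition projection (P : H -> H) :=
  [/\ bounded_operators P, P \o P = P & is_adjoint P P].

Definition infinite_rank (A : H -> H) := ~ finite_dimensional (range A).

(** The image of the closed unit ball has compact closure. *)
Definition compact_operator (A : H -> H) :=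
  bounded_operators A /\ precompact (A @` [set x | `|x| <= 1]).

Definition compression (P : H -> H) (V : set (H -> H)) : set (H -> H) :=
  [set P \o A \o P | A in V].

(** The coarsest topology making every A |-> <A x, y> continuous; on
    [bounded_operators] it induces the weak operator topology. *)
Definition matrix_coefficients (A : H -> H) : {ptws (H * H)%type -> R[i]^o} :=
  fun xy => dot (A xy.1) xy.2.

Definition weak_operator := initial_topology matrix_coefficients.

Definition infinite_quantum_clique (V : set (H -> H)) (P : H -> H) :=
  [/\ projection P, infinite_rank P &
      compression P bounded_operators `<=`
        closure (compression P V : set weak_operator)].

Definition infinite_quantum_almost_anticlique
    (V : set (H -> H)) (P : H -> H) :=
  [/\ projection P, infinite_rank P,
      finite_dimensional (compression P V) &
      forall A, compression P V A ->
        exists (c : R[i]) (K : H -> H), compact_operator K /\ A = c *: P + K].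

End Operators.

(* Main.v *)
Require Import Defs.
From mathcomp Require Import all_boot all_order all_algebra sesquilinear.
From mathcomp Require Import complex.
From mathcomp Require Import all_classical all_reals.
From mathcomp Require Import topology normedtype sequences.
From mathcomp Require Import ring lra zify.

Set Implicit Arguments.
Unset Strict Implicit.
Unset Printing Implicit Defensive.

Import Order.TTheory GRing.Theory Num.Theory.
Import numFieldNormedType.Exports.

Local Open Scope classical_set_scope.
Local Open Scope ring_scope.

(** If some compression [P V P] of infinite rank is finite dimensional, pick an
    orthonormal sequence in the range of [P] along which a basis of [P V P] is
    diagonal with rapidly convergent diagonal entries.  The projection onto its
    closed span is an almost anticlique: every compressed operator is a scalar
    plus a diagonal operator whose entries tend to zero
    ([finite_dimensional_compression_almost_anticlique]).

    Otherwise no compression of infinite rank is finite dimensional, and a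
    clique is built in two steps.

    First, an orthonormal sequence [a] and operators [B n] in [V] are chosen
    alternately such that each [B n] is diagonal along [a], with diagonal
    [0, ..., 0, 1, d, d', ...] where the [1] is at position [n] and the later
    entries are very small ([exists_triangular_system]).  Later vectors with
    small entries exist because [B n] is taken in the kernel of a state at
    infinity, an ultrafilter limit of the vector states of unit vectors that
    leave every finite dimensional subspace.  This is one linear condition on
    [B n], and finitely many more make its earlier entries vanish.  The
    orthogonality conditions that decouple [a n] from the earlier vectors depend
    on [B n], but their number does not.  Were they incompatible with
    [dot (B n (a n)) (a n) <> 0], all forms [<B x, y>] for [B] satisfying the
    linear conditions would have bounded rank on an infinite dimensional
    subspace, hence vanish together on a smaller one
    ([bounded_rank_common_kernel]), and [V] would have a finite dimensional
    compression of infinite rank.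

    Second, a linear space of operators is weakly dense as soon as no nonzero
    finite rank functional vanishes on it ([weakly_dense_compression]).  A
    finite rank functional vanishing at all [B n] has zero diagonal with respect
    to [a] ([triangular_diagonal_eq0]).  The closed span of [a] contains an
    orthonormal sequence [e] any two members of which have some coordinates to
    themselves, where all other members vanish; a functional living on the
    closed span of [e] is then recovered from its diagonal with respect to [a]
    by polarization ([exists_polarizing_sequence]).  The projection onto the
    closed span of [e] is a clique. *)

(** * Sequential choices and linear subsets of a vector space *)

(** Dependent choice along finite histories: if every admissible history [s]
    can be prolonged by some [x] related to it, there is a sequence all of
    whose initial segments are admissible. *)
Lemma sequential_choice (X : Type) (Inv : seq X -> Prop)
    (Q : seq X -> X -> Prop) :
  Inv [::] -> (forall s, Inv s -> exists x, Inv (rcons s x) /\ Q s x) ->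
  exists f : nat -> X, forall n, Q (mkseq f n) (f n).
Proof.
move=> Inv0 step.
have [x0 _] := step _ Inv0.
have [next nextP] : {next : seq X -> X & forall s, Inv s ->
    Inv (rcons s (next s)) /\ Q s (next s)}.
  apply: (@choice _ _ (fun s x => Inv s -> Inv (rcons s x) /\ Q s x)) => s.
  by have [/step[x]|] := pselect (Inv s); [exists x | exists x0].
pose fix hist n := if n is m.+1 then rcons (hist m) (next (hist m)) else [::].
pose f n := next (hist n).
have histE n : hist n = mkseq f n by elim: n => // n IH; rewrite mkseqS -IH.
have Inv_hist n : Inv (hist n) by elim: n => //= n /nextP[].
by exists f => n; rewrite -histE; exact: (nextP _ (Inv_hist n)).2.
Qed.

Section LinearSets.
Variables (K : fieldType) (U W : lmodType K).

(** Linear subspaces, given as sets. *)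
Definition linear_set (A : set U) :=
  A 0 /\ forall a x y, A x -> A y -> A (a *: x + y).

(** Scalar functions that are linear on the set [A] only. *)
Definition linear_on (A : set U) (f : U -> K) :=
  forall a x y, A x -> A y -> f (a *: x + y) = a * f x + f y.

Lemma linear_set_sum (A : set U) n (c : 'I_n -> K) (x : 'I_n -> U) :
  linear_set A -> (forall i, A (x i)) -> A (\sum_i c i *: x i).
Proof.
move=> [A0 AL] Ax; apply: big_ind => // [u v Au Av|i _].
- by rewrite -[u]scale1r; exact: AL.
- by rewrite -[_ *: _]addr0; exact: AL.
Qed.

Lemma linear_setZ (A : set U) a x : linear_set A -> A x -> A (a *: x).
Proof. by move=> [A0 AL] Ax; rewrite -[_ *: _]addr0; exact: AL. Qed.

Lemma linear_on0 (A : set U) f : linear_set A -> linear_on A f -> f 0 = 0.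
Proof.
move=> [A0 _] /(_ 1 _ _ A0 A0); rewrite scaler0 addr0 mul1r => /esym/eqP.
by rewrite -subr_eq0 addrK => /eqP.
Qed.

Lemma linear_setI_ker (A : set U) f :
  linear_set A -> linear_on A f -> linear_set (A `&` [set x | f x = 0]).
Proof.
move=> AL fL; split; first by split; [exact: AL.1 | exact: linear_on0 fL].
move=> a x y [Ax fx] [Ay fy]; split; first exact: AL.2.
by rewrite /= fL// fx fy mulr0 addr0.
Qed.

Lemma linear_setI_kers (A : set U) (fs : seq (U -> K)) :
  linear_set A -> (forall f, f \in fs -> linear_on A f) ->
  linear_set (A `&` [set x | forall f, f \in fs -> f x = 0]).
Proof.
move=> AL fL; split.
  by split; [exact: AL.1 | move=> f /fL; exact: linear_on0].
move=> a x y [Ax fx] [Ay fy]; split; first exact: AL.2.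
by move=> f ffs; rewrite (fL _ ffs)// fx// fy// mulr0 addr0.
Qed.

Lemma linear_on_sub (A B : set U) f :
  A `<=` B -> linear_on B f -> linear_on A f.
Proof. by move=> AB fL a x y /AB Bx /AB By; exact: fL. Qed.

(** A linear image is finite dimensional as soon as the image of a
    hyperplane is. *)
Lemma finite_dimensional_ker (A : set U) (Phi : U -> W) f :
  linear Phi -> linear_set A -> linear_on A f ->
  finite_dimensional (Phi @` (A `&` [set x | f x = 0])) ->
  finite_dimensional (Phi @` A).
Proof.
move=> PhiL AL fL [n [e [eA eP]]].
have [A0|] := pselect (forall x, A x -> f x = 0).
  exists n, e; split=> [i|_ [x Ax <-]].
    by have [x [Ax _] <-] := eA i; exists x.
  by apply: eP; exists x => //; split=> //; exact: A0.
move/existsNP => [b] /not_implyP[Ab /eqP fb].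
pose e' (i : 'I_n.+1) := if unlift ord0 i is Some j then e j else Phi b.
exists n.+1, e'; split=> [i|_ [x Ax <-]].
  rewrite /e'; case: unliftP => [j _|_]; last by exists b.
  by have [y [Ay _] <-] := eA j; exists y.
have [|c cE] := eP (Phi (- (f x / f b) *: b + x)).
  exists (- (f x / f b) *: b + x) => //; split; first exact: AL.2.
  by rewrite /= fL// mulNr mulfVK// addNr.
pose c' (i : 'I_n.+1) :=
  if unlift ord0 i is Some j then c j else f x / f b.
exists c'; rewrite big_ord_recl /c' /e' unlift_none.
under eq_bigr do rewrite liftK.
by rewrite -cE PhiL addrA -scalerDl subrr scale0r add0r.
Qed.

(** The same for a subspace cut out by finitely many linear conditions. *)
Lemma finite_dimensional_kers (A : set U) (Phi : U -> W)
    (fs : seq (U -> K)) :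
  linear Phi -> linear_set A -> (forall f, f \in fs -> linear_on A f) ->
  finite_dimensional
    (Phi @` (A `&` [set x | forall f, f \in fs -> f x = 0])) ->
  finite_dimensional (Phi @` A).
Proof.
move=> PhiL; elim: fs A => [|f fs IH] A AL fsL.
  by rewrite (_ : A `&` _ = A)//; apply/seteqP; split=> [x []|x Ax].
move=> fd; have fL : linear_on A f by apply: fsL; rewrite mem_head.
apply: (finite_dimensional_ker PhiL AL fL); apply: IH.
- exact: linear_setI_ker.
- move=> g gfs; apply: (@linear_on_sub _ A); first exact: subIsetl.
  by apply: fsL; rewrite in_cons gfs orbT.
- rewrite (_ : _ `&` _ = A `&` [set x | forall g, g \in f :: fs -> g x = 0])//.
  apply/seteqP; split=> x.
    by move=> [[Ax fx0] fsx]; split=> // g /predU1P[->//|]; exact: fsx.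
  move=> [Ax fsx]; split; [split=> //; apply: fsx; exact: mem_head|].
  by move=> g gfs; apply: fsx; rewrite in_cons gfs orbT.
Qed.

End LinearSets.
Arguments linear_set {K U} A.
(** * Elementary Hilbert space geometry *)

Section Geometry.
Variables (R : realType) (H : completeNormedModType R[i]).
Variable dot : {dot H for (@Num.conj R[i])}.
Hypothesis dot_norm : forall x : H, `|x| ^+ 2 = dot x x.
Local Notation C := R[i].

Lemma dotDl x y z : dot (x + y) z = dot x z + dot y z.
Proof. exact: linearDl. Qed.

Lemma dotBl x y z : dot (x - y) z = dot x z - dot y z.
Proof. exact: linearBl. Qed.

Lemma dotZl a x z : dot (a *: x) z = a * dot x z.
Proof. exact: linearZl_LR. Qed.

Lemma dotDr x y z : dot z (x + y) = dot z x + dot z y.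
Proof. exact: linearDr. Qed.

Lemma dotBr x y z : dot z (x - y) = dot z x - dot z y.
Proof. exact: linearBr. Qed.

Lemma dotZr a x z : dot z (a *: x) = a^* * dot z x.
Proof. exact: linearZr_LR. Qed.

Lemma dot0l z : dot 0 z = 0.
Proof. exact: linear0l. Qed.

Lemma dot0r z : dot z 0 = 0.
Proof. exact: linear0r. Qed.

Lemma dotC x y : dot x y = (dot y x)^*.
Proof. by rewrite (hermC dot) expr0 mul1r. Qed.

Lemma dot_eq0C x y : dot x y = 0 -> dot y x = 0.
Proof. by move=> xy0; rewrite dotC xy0 conjC0. Qed.

Lemma dot_suml I r (P : pred I) (F : I -> H) z :
  dot (\sum_(i <- r | P i) F i) z = \sum_(i <- r | P i) dot (F i) z.
Proof. exact: linear_sumlz. Qed.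

Lemma dot_sumr I r (P : pred I) (F : I -> H) z :
  dot z (\sum_(i <- r | P i) F i) = \sum_(i <- r | P i) dot z (F i).
Proof. exact: linear_sumr. Qed.

Lemma CauchySchwarz x y : `|dot x y| <= `|x| * `|y|.
Proof.
have [->|y0] := eqVneq y 0; first by rewrite dot0r !normr0 mulr0.
have yy : 0 < dot y y by rewrite dnorm_gt0.
rewrite -(@ler_pXn2r _ 2) ?nnegrE ?mulr_ge0// exprMn !dot_norm.
rewrite -subr_ge0 -(pmulr_rge0 _ yy).
have := dnorm_ge0 dot (dot y y *: x - dot x y *: y).
rewrite dotBl !dotBr !dotZl !dotZr (geC0_conj (ltW yy)) normCK [dot y x]dotC.
by move=> h; apply: etrans h; congr (0 <= _); ring.
Qed.

Lemma dot_ext x y : (forall z, dot x z = dot y z) -> x = y.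
Proof.
move=> xy; apply/eqP; rewrite -subr_eq0 -(dnorm_eq0 dot).
by rewrite dotBl xy subrr.
Qed.

Lemma pythagoras x y : dot x y = 0 -> `|x + y| ^+ 2 = `|x| ^+ 2 + `|y| ^+ 2.
Proof. by move=> xy; rewrite !dot_norm; apply: (hnormDd (form := dot)). Qed.

Lemma unit_norm x : dot x x = 1 -> `|x| = 1.
Proof.
by move=> x1; apply/eqP; rewrite -(@pexpr_eq1 _ _ 2)// dot_norm x1.
Qed.

Lemma normalize x : x != 0 -> dot (`|x|^-1 *: x) (`|x|^-1 *: x) = 1.
Proof.
move=> x0; rewrite dnormZ -dot_norm normfV normr_id -exprMn mulVf ?normr_eq0//.
by rewrite expr1n.
Qed.

Lemma dot_cvg {I} (F : set_system I) {FF : Filter F} (u v : I -> H) x y :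
  u @ F --> x -> v @ F --> y ->
  (fun i => dot (u i) (v i) : C^o) @ F --> (dot x y : C^o).
Proof.
move=> ux vy.
rewrite (_ : (fun i => dot (u i) (v i)) = fun i =>
  dot (u i - x) (v i - y) + (dot (u i - x) y + dot x (v i - y)) + dot x y);
  last by apply/funext => i; rewrite !(dotBl, dotBr); ring.
rewrite -[X in _ --> X]add0r; apply: cvgD; last exact: cvg_cst.
have ux0 : (fun i => u i - x) @ F --> 0.
  by rewrite -(subrr x); apply: cvgB => //; exact: cvg_cst.
have vy0 : (fun i => v i - y) @ F --> 0.
  by rewrite -(subrr y); apply: cvgB => //; exact: cvg_cst.
have dom0 (w : I -> C^o) (g : I -> C^o) : g @ F --> (0 : C^o) ->
    (forall i, `|w i| <= `|g i|) -> w @ F --> (0 : C^o).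
  move=> g0 wg; apply/cvgr0Pnorm_le => e e0.
  by move/cvgr0Pnorm_le/(_ e e0): g0; apply: filterS => i; apply: le_trans.
rewrite -[X in _ --> X]addr0; apply: cvgD.
  apply: (dom0 _ (fun i => `|u i - x| * `|v i - y|)).
    by rewrite -[X in _ --> X](mulr0 0); apply: cvgM;
      rewrite -[X in _ --> X](@normr0 _ H); exact: cvg_norm.
  by move=> i; rewrite normrM !normr_id; exact: CauchySchwarz.
rewrite -[X in _ --> X]addr0; apply: cvgD.
  apply: (dom0 _ (fun i => `|u i - x| * `|y|)).
    by rewrite -[X in _ --> X](mul0r `|y|); apply: cvgM; [
      rewrite -[X in _ --> X](@normr0 _ H); exact: cvg_norm | exact: cvg_cst].
  by move=> i; rewrite normrM !normr_id; exact: CauchySchwarz.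
apply: (dom0 _ (fun i => `|x| * `|v i - y|)).
  by rewrite -[X in _ --> X](mulr0 `|x|); apply: cvgM; [exact: cvg_cst |
    rewrite -[X in _ --> X](@normr0 _ H); exact: cvg_norm].
by move=> i; rewrite normrM !normr_id; exact: CauchySchwarz.
Qed.

Lemma dot_cvgl {I} (F : set_system I) {FF : Filter F} (u : I -> H) x y :
  u @ F --> x -> (fun i => dot (u i) y : C^o) @ F --> (dot x y : C^o).
Proof. by move=> ux; apply: dot_cvg => //; exact: cvg_cst. Qed.

Section Bounded.
Variable A : H -> H.
Hypothesis Abd : bounded_operators A.

Lemma bddP a x y : A (a *: x + y) = a *: A x + A y.
Proof. by case: Abd => AL _; exact: AL. Qed.

Lemma bdd0 : A 0 = 0.
Proof.
have := bddP 1 0 0; rewrite scaler0 addr0 scale1r => /esym/eqP.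
by rewrite -subr_eq0 addrK => /eqP.
Qed.

Lemma bddD x y : A (x + y) = A x + A y.
Proof. by rewrite -[x]scale1r bddP !scale1r. Qed.

Lemma bddZ a x : A (a *: x) = a *: A x.
Proof. by rewrite -[a *: x]addr0 bddP bdd0 addr0. Qed.

Lemma bddB x y : A (x - y) = A x - A y.
Proof. by rewrite bddD -scaleN1r bddZ scaleN1r. Qed.

Lemma bdd_sum I r (P : pred I) (F : I -> H) :
  A (\sum_(i <- r | P i) F i) = \sum_(i <- r | P i) A (F i).
Proof. by rewrite (big_morph A bddD bdd0). Qed.

Lemma bdd_bound : exists2 M : C, 0 < M & forall x, `|A x| <= M * `|x|.
Proof.
case: Abd => _ [M MP]; exists (`|M| + 1); first by rewrite ltr_wpDl.
move=> x; apply: (le_trans (MP x)).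
have Mx0 : 0 <= M * `|x| by rewrite (le_trans _ (MP x)).
by rewrite -(ger0_norm Mx0) normrM normr_id ler_wpM2r// lerDl.
Qed.

Lemma bdd_cvg {I} (F : set_system I) {FF : Filter F} (u : I -> H) x :
  u @ F --> x -> (A \o u) @ F --> A x.
Proof.
move=> ux; have [M M0 MP] := bdd_bound.
apply/cvgrPdist_le => e e0; move/cvgrPdist_le : ux => /(_ (e / M)).
rewrite divr_gt0// => /(_ isT); apply: filterS => i uxi /=.
rewrite -bddB (le_trans (MP _))// (le_trans (ler_wpM2l (ltW M0) uxi))//.
by rewrite mulrC divfK// gt_eqF.
Qed.

End Bounded.

(** The vectors orthogonal to all members of the list [W]. *)
Definition orthogonal_to (W : seq H) : set H :=
  [set x | forall w, w \in W -> dot x w = 0].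

Lemma orthogonal_to_cat W1 W2 :
  orthogonal_to (W1 ++ W2) = orthogonal_to W1 `&` orthogonal_to W2.
Proof.
apply/seteqP; split=> [x xW|x [x1 x2] w]; last first.
  by rewrite mem_cat => /orP[/x1|/x2].
by split=> w wW; apply: xW; rewrite mem_cat wW ?orbT.
Qed.

Lemma linear_set_orthogonal (T : set H) W :
  linear_set T -> linear_set (T `&` orthogonal_to W).
Proof.
move=> TL; split; first by split; [exact: TL.1 | move=> w _; exact: dot0l].
move=> a x y [Tx xW] [Ty yW]; split; first exact: TL.2.
by move=> w wW; rewrite dotDl dotZl xW// yW// mulr0 addr0.
Qed.

Lemma orthogonal_infinite (T : set H) W :
  linear_set T -> ~ finite_dimensional T ->
  ~ finite_dimensional (T `&` orthogonal_to W).
Proof.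
move=> TL; apply: contra_not => fd.
rewrite -(image_id T).
apply: (@finite_dimensional_kers _ _ _ T idfun [seq (dot^~ w) | w <- W]) => //.
  by move=> _ /mapP[w _ ->] a x y _ _; rewrite dotDl dotZl.
rewrite image_id (_ : _ `&` _ = T `&` orthogonal_to W)//.
apply/seteqP; split=> x [Tx xW]; split=> //.
  by move=> w wW; apply: (xW (dot^~ w)); apply/mapP; exists w.
by move=> _ /mapP[w wW ->]; exact: xW.
Qed.

Lemma infinite_unit (T : set H) :
  linear_set T -> ~ finite_dimensional T -> exists2 x, T x & dot x x = 1.
Proof.
move=> TL infT; have [x Tx x0] : exists2 x, T x & x != 0.
  apply: contra_notP infT => T0; exists 0%N, (fun=> 0); split=> [[]//|x Tx].
  exists (fun=> 0); rewrite big_ord0; apply/eqP.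
  by apply: contra_notT T0 => x0; exists x.
by exists (`|x|^-1 *: x); [exact: linear_setZ | exact: normalize].
Qed.

Lemma infinite_unit_orthogonal (T : set H) W :
  linear_set T -> ~ finite_dimensional T ->
  exists x, [/\ T x, orthogonal_to W x & dot x x = 1].
Proof.
move=> TL infT; have [|x [Tx xW] x1] := infinite_unit (linear_set_orthogonal W TL).
  exact: orthogonal_infinite.
by exists x.
Qed.

End Geometry.
(** * Orthonormal sequences and their projections *)

Lemma sum_nat_single (V : zmodType) (F : nat -> V) m n j :
  (forall k, k != j -> F k = 0) ->
  \sum_(m <= k < n) F k = if (m <= j < n)%N then F j else 0.
Proof.
move=> F0; case: ifP => [jmn|jmn].
  rewrite (bigD1_seq j) ?mem_index_iota ?iota_uniq//= big1 ?addr0//.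
rewrite big1_seq// => k; rewrite mem_index_iota => /andP[_ kmn].
by apply: F0; apply: contraFneq jmn => <-.
Qed.

Section Orthonormal.
Variables (R : realType) (H : completeNormedModType R[i]).
Variable dot : {dot H for (@Num.conj R[i])}.
Hypothesis dot_norm : forall x : H, `|x| ^+ 2 = dot x x.
Local Notation C := R[i].

Lemma lim_eventually (V : normedModType C) (u : nat -> V) l l' N :
  u @ \oo --> l -> (forall n, (N <= n)%N -> u n = l') -> l = l'.
Proof.
move=> ul uN; apply: (cvg_unique (@norm_hausdorff _ _) ul).
by apply: cvg_near_cst; exists N => // n /= /uN ->.
Qed.

Lemma cvg_norm_le (V : normedModType C) {I} (F : set_system I)
    {FF : ProperFilter F} (u : I -> V) l M :
  u @ F --> l -> (\forall i \near F, `|u i| <= M) -> `|l| <= M.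
Proof.
move=> ul uM; have M0 : 0 <= M.
  by have [j] := filter_ex uM; apply: le_trans.
rewrite real_leNgt ?ger0_real//; apply/negP => Ml.
have [j [Mj]] := filter_ex (filterI (cvgr_norm_gt _ ul _ Ml) uM).
by rewrite (lt_geF Mj).
Qed.

Definition orthonormal_sequence (a : nat -> H) :=
  forall i j, dot (a i) (a j) = (i == j)%:R.

Variable a : nat -> H.
Hypothesis a_on : orthonormal_sequence a.

Lemma dot_sum_orthonormal (c : nat -> C) m n j :
  dot (\sum_(m <= k < n) c k *: a k) (a j) =
  if (m <= j < n)%N then c j else 0.
Proof.
rewrite dot_suml (@sum_nat_single _ _ _ _ j) => [|k /negPf kj].
  by rewrite dotZl a_on eqxx mulr1.
by rewrite dotZl a_on kj mulr0.
Qed.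

Lemma norm_sum_orthonormal (c : nat -> C) m n :
  `|\sum_(m <= k < n) c k *: a k| ^+ 2 = \sum_(m <= k < n) `|c k| ^+ 2.
Proof.
rewrite dot_norm dot_sumr; apply: eq_big_nat => k kmn.
by rewrite dotZr dot_sum_orthonormal kmn mulrC -normCK.
Qed.

Lemma bessel x m n : \sum_(m <= k < n) `|dot x (a k)| ^+ 2 <= `|x| ^+ 2.
Proof.
set s := \sum_(m <= k < n) dot x (a k) *: a k.
rewrite -norm_sum_orthonormal -/s -[x in leRHS](subrK s).
rewrite (pythagoras dot_norm) ?lerDr ?exprn_ge0//.
rewrite /s dot_sumr big_nat big1// => k kmn; rewrite dotZr dotBl.
by rewrite dot_sum_orthonormal kmn subrr mulr0.
Qed.

Lemma square_summable_cvg (c : nat -> C) M :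
  (forall n, \sum_(0 <= k < n) `|c k| ^+ 2 <= M) ->
  cvgn (fun n => \sum_(0 <= k < n) c k *: a k).
Proof.
move=> cM; pose r k : R := complex.Re (`|c k| ^+ 2).
have rE m n : \sum_(m <= k < n) `|c k| ^+ 2 = (\sum_(m <= k < n) r k)%:C%C.
  rewrite rmorph_sum; apply: eq_bigr => k _.
  exact/esym/RRe_real/ger0_real/exprn_ge0.
have r0 k : 0 <= r k by rewrite /r -ler0c RRe_real ?ger0_real ?exprn_ge0.
have : cvgn (series r).
  apply: nondecreasing_is_cvgn; first exact: nondecreasing_series.
  exists (complex.Re M) => _ [n _ <-] /=; have := cM n.
  by rewrite rE lecE /= => /andP[].
move/cvg_cauchy/cauchy_seriesP => r_cauchy.
apply: (@cauchy_cvg _ (series (fun k => c k *: a k) @ \oo)).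
apply/cauchy_seriesP => e e0.
have e0' : 0 < complex.Re (e ^+ 2) by rewrite -ltcR RRe_real ?gtr0_real ?exprn_gt0.
have := r_cauchy _ e0'; apply: filterS => -[m n] /=.
rewrite ger0_norm ?sumr_ge0// => rmn.
rewrite -(@ltr_pXn2r _ 2) ?nnegrE ?(ltW e0)//.
rewrite [ltLHS](_ : _ = (\sum_(m <= k < n) r k)%:C%C); last first.
  by rewrite -rE; exact: norm_sum_orthonormal.
by rewrite -[ltRHS]RRe_real ?gtr0_real ?exprn_gt0// ltcR.
Qed.

(** The orthogonal projection onto the closed span of [a]. *)
Definition proj (x : H) : H :=
  limn (fun n => \sum_(0 <= k < n) dot x (a k) *: a k).

Lemma proj_cvg x :
  (fun n => \sum_(0 <= k < n) dot x (a k) *: a k) @ \oo --> proj x.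
Proof. exact: (square_summable_cvg (bessel x 0)). Qed.
Arguments proj_cvg : clear implicits.

Lemma dot_proj x y : (fun n => \sum_(0 <= k < n) dot x (a k) * dot (a k) y : C^o)
  @ \oo --> (dot (proj x) y : C^o).
Proof.
rewrite (_ : (fun n => _) =
  fun n => dot (\sum_(0 <= k < n) dot x (a k) *: a k) y : C^o).
  by apply: dot_cvgl => //; exact: proj_cvg.
apply/funext => n; rewrite dot_suml; apply: eq_bigr => k _.
by rewrite dotZl.
Qed.

Arguments dot_proj : clear implicits.

Lemma proj_coef x j : dot (proj x) (a j) = dot x (a j).
Proof.
apply: (lim_eventually (N := j.+1)
  (@dot_cvgl _ _ dot dot_norm _ _ _ _ _ (a j) (proj_cvg x))) => n jn.
by rewrite dot_sum_orthonormal jn.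
Qed.

Lemma proj_in j : proj (a j) = a j.
Proof.
apply: (lim_eventually (N := j.+1) (proj_cvg (a j))) => n jn.
rewrite (@sum_nat_single _ _ _ _ j) => [|k kj]; last first.
  by rewrite a_on eq_sym (negPf kj) scale0r.
by rewrite jn a_on eqxx scale1r.
Qed.

(** Riesz-Fischer: square summable coefficients come from a vector in the
    closed span of [a]. *)
Lemma exists_of_coefs (c : nat -> C) M :
  (forall n, \sum_(0 <= k < n) `|c k| ^+ 2 <= M) ->
  exists x, proj x = x /\ forall n, dot x (a n) = c n.
Proof.
move=> cM; pose x := limn (fun n => \sum_(0 <= k < n) c k *: a k).
have x_cvg : (fun n => \sum_(0 <= k < n) c k *: a k) @ \oo --> x.
  exact: (square_summable_cvg cM).
have x_coef n : dot x (a n) = c n.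
  apply: (lim_eventually (N := n.+1) (dot_cvgl dot_norm (y := a n) x_cvg)) => m nm.
  by rewrite dot_sum_orthonormal nm.
exists x; split=> //; rewrite {1}/proj.
by under [X in limn X]eq_fun do under eq_bigr do rewrite x_coef.
Qed.

Lemma proj_linear b x y : proj (b *: x + y) = b *: proj x + proj y.
Proof.
apply: (cvg_unique (@norm_hausdorff _ _) (proj_cvg (b *: x + y))).
rewrite (_ : (fun n => _) = fun n => b *: (\sum_(0 <= k < n) dot x (a k) *: a k)
   + \sum_(0 <= k < n) dot y (a k) *: a k).
  by apply: cvgD; [apply: cvgZr|]; exact: proj_cvg.
apply/funext => n; rewrite scaler_sumr -big_split; apply: eq_bigr => k _ /=.
by rewrite dotDl dotZl scalerDl scalerA.
Qed.

Lemma proj_bounded : bounded_operators proj.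
Proof.
split; first by move=> b x y; exact: proj_linear.
exists 1 => x; rewrite mul1r.
apply: (cvg_norm_le (proj_cvg x)); apply: nearW => n.
by rewrite -(@ler_pXn2r _ 2) ?nnegrE// norm_sum_orthonormal bessel.
Qed.

Lemma proj_adjoint : is_adjoint dot proj proj.
Proof.
move=> x y; apply: (cvg_unique (@norm_hausdorff _ _) (dot_proj x y)).
rewrite (_ : (fun n => _) =
  fun n => dot x (\sum_(0 <= k < n) dot y (a k) *: a k) : C^o).
  by apply: (dot_cvg dot_norm); [exact: cvg_cst | exact: proj_cvg].
apply/funext => n; rewrite dot_sumr; apply: eq_bigr => k _.
by rewrite dotZr -dotC mulrC.
Qed.

Lemma proj_idem x : proj (proj x) = proj x.
Proof.
rewrite {1}/proj (_ : (fun n => _) =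
  fun n => \sum_(0 <= k < n) dot x (a k) *: a k)//.
by apply/funext => n; apply: eq_bigr => k _; rewrite proj_coef.
Qed.

Lemma proj_projection : projection dot proj.
Proof.
split; [exact: proj_bounded | | exact: proj_adjoint].
by apply/funext => x; exact: proj_idem.
Qed.

(** An infinite orthonormal sequence does not fit in the span of finitely many
    vectors: with one more [a i] than spanning vectors, a nontrivial
    combination of the [a i] vanishes. *)
Lemma orthonormal_infinite (A : set H) :
  (forall i, A (a i)) -> ~ finite_dimensional A.
Proof.
move=> Aa [n [e [_ eP]]].
have /choice[c cE] : forall i : 'I_n.+1, exists c : 'I_n -> C,
  a i = \sum_j c j *: e j by move=> i; apply: eP.
pose M : 'M[C]_(n.+1, n) := \matrix_(i, j) c i j.
have : (0 < \rank (kermx M))%N.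
  by rewrite mxrank_ker subn_gt0 ltnS rank_leq_col.
rewrite lt0n mxrank_eq0 => /rowV0Pn[u /sub_kermxP uM u0].
suff : u = 0 by apply/eqP.
apply/rowP => j; rewrite mxE.
have ua0 : \sum_(i < n.+1) u 0 i *: a i = 0.
  under eq_bigr do rewrite cE scaler_sumr.
  rewrite exchange_big big1// => k _; under eq_bigr do rewrite scalerA.
  rewrite -scaler_suml (_ : \sum_i _ = (u *m M) 0 k).
    by rewrite uM mxE scale0r.
  by rewrite mxE; apply: eq_bigr => i _; rewrite mxE.
have := congr1 (dot^~ (a j)) ua0; rewrite dot0l dot_suml (bigD1 j)//=.
rewrite dotZl a_on eqxx mulr1 big1 ?addr0// => i ij.
by rewrite dotZl a_on (_ : (_ == _) = false) ?mulr0//; apply: negbTE.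
Qed.

Lemma proj_infinite_rank : infinite_rank proj.
Proof. by apply: orthonormal_infinite => i; exists (a i) => //; exact: proj_in. Qed.

End Orthonormal.
Arguments proj_cvg {R H dot} dot_norm {a} a_on x.
Arguments dot_proj {R H dot} dot_norm {a} a_on x y.
(** * States at infinity and diagonalizing sequences *)

Lemma ultra_fmap (T U : Type) (f : T -> U) (F : set_system T) :
  UltraFilter F -> UltraFilter (f @ F).
Proof.
move=> FU; split; first exact: fmap_proper_filter.
move=> G GF sFG; rewrite predeqE => A; split; last exact: sFG.
move=> GA; have [//|FnA] := in_ultra_setVsetC (f @^-1` A) FU.
have /filter_ex[x []//] : G (A `&` ~` A).
by apply: filterI => //; exact: sFG.
Qed.

Section StatesAtInfinity.
Variables (R : realType) (H : completeNormedModType R[i]).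
Variable dot : {dot H for (@Num.conj R[i])}.
Hypothesis dot_norm : forall x : H, `|x| ^+ 2 = dot x x.
Local Notation C := R[i].

Lemma real_complex_cvg I (F : set_system I) {FF : Filter F} (r : I -> R) (l : R) :
  r @ F --> l -> (fun i => (r i)%:C%C : C^o) @ F --> (l%:C%C : C^o).
Proof.
move=> rl; apply/cvgrPdist_le => e e0.
have eE : (complex.Re e)%:C%C = e by rewrite RRe_real ?gtr0_real.
move/cvgrPdist_le : rl => /(_ (complex.Re e)).
rewrite -ltcR eE => /(_ e0); apply: filterS => i.
rewrite -lecR eE; apply: le_trans.
by rewrite -rmorphB normc_def /= expr0n /= addr0 sqrtr_sqr.
Qed.

Lemma ultra_cvg_bounded I (G : set_system I) {GU : UltraFilter G}
    (f : I -> C^o) (M : C) :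
  G [set i | `|f i| <= M] -> cvg (f @ G).
Proof.
move=> GM; have GF : ProperFilter G by exact: ultra_proper.
have part (r : I -> R) : (forall i, `|r i|%:C%C <= `|f i|) ->
    exists l : R, r @ G --> l.
  move=> rf; have := @segment_compact _ (- complex.Re M) (complex.Re M).
  rewrite compact_ultra => /(_ (r @ G)) rG.
  have [||l [_ rl]] := rG; [exact: ultra_fmap | | by exists l].
  apply: (@filterS _ G _ _ _ _ GM) => i /(le_trans (rf i)) rM /=.
  by rewrite in_itv /= -ler_norml; move: rM; rewrite lecE => /andP[].
have [l1 fl1] : exists l : R, (fun i => complex.Re (f i)) @ G --> l.
  by apply: part => i; exact: normc_ge_Re.
have [l2 fl2] : exists l : R, (fun i => complex.Im (f i)) @ G --> l.
  apply: part => i; have := normc_ge_Re (f i * 'i%C).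
  rewrite ReiNIm normrN => /le_trans; apply.
  by rewrite normrM complexiE normCi mulr1.
apply/cvg_ex; exists (l1%:C%C + 'i%C * l2%:C%C).
rewrite (_ : f = fun i => (complex.Re (f i))%:C%C + 'i%C * (complex.Im (f i))%:C%C).
  apply: cvgD; first exact: real_complex_cvg fl1.
  by apply: cvgM; [exact: cvg_cst | exact: real_complex_cvg fl2].
by apply/funext => i; rewrite -complexE.
Qed.

(** A limit of the vector states [B |-> <B x, x>], for unit vectors [x] in [T]
    that leave every finite dimensional subspace.  Only its linearity on
    bounded operators and the existence of vectors approximating it at finitely
    many operators, orthogonally to finitely many vectors, are recorded. *)
Definition state_at_infinity (T : set H) (lambda : (H -> H) -> C) :=
  linear_on (@bounded_operators R H) lambda /\
  forall (Bs : seq (H -> H)) (W : seq H) e,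
    (forall B, B \in Bs -> bounded_operators B) -> 0 < e ->
    exists x, [/\ T x, orthogonal_to dot W x, dot x x = 1 &
      forall B, B \in Bs -> `|dot (B x) x - lambda B| <= e].

Lemma exists_state_at_infinity (T : set H) :
  linear_set T -> ~ finite_dimensional T ->
  exists lambda, state_at_infinity T lambda.
Proof.
move=> TL infT.
pose far (W : seq H) := [set x | [/\ T x, orthogonal_to dot W x & dot x x = 1]].
pose F0 := filter_from [set: seq H] far.
have F0F : Filter F0.
  apply: filter_fromT_filter; first by exists [::].
  move=> W1 W2; exists (W1 ++ W2) => x [Tx + x1].
  by rewrite orthogonal_to_cat => -[xW1 xW2].
have F0P : ProperFilter F0.
  apply: filter_from_proper => W _.
  by have [x [Tx xW x1]] := infinite_unit_orthogonal dot_norm W TL infT; exists x.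
have [G [GU F0G]] := ultraFilterLemma F0P.
have GF : ProperFilter G by exact: ultra_proper.
have Gfar W : G (far W) by apply: F0G; exists W.
pose lambda B := lim ((fun x => dot (B x) x : C^o) @ G).
have lambdaP B : bounded_operators B ->
    (fun x => dot (B x) x : C^o) @ G --> (lambda B : C^o).
  move=> Bbd; have [M M0 BM] := bdd_bound Bbd.
  apply: (@ultra_cvg_bounded _ G GU _ M).
  apply: filterS (Gfar [::]) => x [_ _ x1] /=.
  apply: le_trans (CauchySchwarz dot_norm _ _) _.
  rewrite (unit_norm dot_norm x1) mulr1.
  by have := BM x; rewrite (unit_norm dot_norm x1) mulr1.
exists lambda; split=> [a A B Abd Bbd|Bs W e Bsbd e0].
  apply: cvg_lim; first exact: norm_hausdorff.
  rewrite (_ : (fun x => _) = fun x => a * dot (A x) x + dot (B x) x).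
    by apply: cvgD; [apply: cvgM; [exact: cvg_cst|]|]; exact: lambdaP.
  by apply/funext => x; rewrite -dotZl -dotDl.
have [|x [[Tx xW x1] xBs]] := @filter_ex _ G _ (far W `&`
    [set x | forall B, B \in Bs -> `|dot (B x) x - lambda B| <= e]).
  apply: filterI => //; elim: Bs Bsbd => [|B Bs IH] Bsbd; first exact: filterE.
  have Bbd : bounded_operators B by apply: Bsbd; exact: mem_head.
  have /cvgrPdist_le/(_ e e0) GB := lambdaP _ Bbd.
  have {IH} := IH (fun A ABs => Bsbd A (mem_behead (s := B :: Bs) ABs)).
  move=> /(filterI GB); apply: filterS => x [xB xBs] A /predU1P[->|/xBs//].
  by rewrite distrC.
by exists x.
Qed.

(** Finitely many operators are simultaneously diagonal along a suitable
    orthonormal sequence, with diagonal entries converging quickly to the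
    values of a state at infinity. *)
Lemma diagonal_sequence (T : set H) lambda (adj : (H -> H) -> H -> H)
    (Bs : seq (H -> H)) :
  state_at_infinity T lambda ->
  (forall B, B \in Bs -> bounded_operators B /\ is_adjoint dot B (adj B)) ->
  exists t, [/\ orthonormal_sequence dot t, forall k, T (t k),
    forall B, B \in Bs -> forall k l, k != l -> dot (B (t k)) (t l) = 0 &
    forall B, B \in Bs -> forall k,
      `|dot (B (t k)) (t k) - lambda B| <= 2^-1 ^+ k].
Proof.
move=> [_ lambdaP] BsP.
(* Orthogonality to [B (t k)] and to [adj B (t k)] for all earlier [k] kills the
   two coefficients of [B] at [(k, l)] and [(l, k)]. *)
pose W (s : seq H) := s ++ [seq B x | B <- Bs, x <- s] ++
                           [seq adj B x | B <- Bs, x <- s].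
have [//|s _|t tP] := @sequential_choice H (fun=> True) (fun s x =>
  [/\ T x, orthogonal_to dot (W s) x, dot x x = 1 &
    forall B, B \in Bs -> `|dot (B x) x - lambda B| <= 2^-1 ^+ size s]).
  have [||x xP] := lambdaP Bs (W s) (2^-1 ^+ size s).
  - by move=> B /BsP[].
  - by rewrite exprn_gt0// invr_gt0.
  by exists x.
have tW k l : (k < l)%N -> [/\ dot (t l) (t k) = 0,
    forall B, B \in Bs -> dot (t l) (B (t k)) = 0 &
    forall B, B \in Bs -> dot (t l) (adj B (t k)) = 0].
  move=> kl; have [_ tl _ _] := tP l.
  have kl' : t k \in mkseq t l by apply: map_f; rewrite mem_iota.
  split=> [|B BBs|B BBs]; apply: tl; rewrite !mem_cat ?kl'//.
  - by apply/orP; right; apply/orP; left; exact: allpairs_f.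
  - by apply/orP; right; apply/orP; right; exact: allpairs_f.
exists t; split.
- move=> k l; have [kl|kl|->] := ltngtP k l; last by have [] := tP l.
    by apply: dot_eq0C; have [] := tW _ _ kl.
  by have [] := tW _ _ kl.
- by move=> k; have [] := tP k.
- move=> B BBs k l; rewrite neq_ltn => /orP[] kl; have [_ tB tadj] := tW _ _ kl.
    by apply: dot_eq0C; exact: tB.
  by have [_ ->] := BsP _ BBs; exact: tadj.
- by move=> B BBs k; have [_ _ _ /(_ B BBs)] := tP k; rewrite size_mkseq.
Qed.

End StatesAtInfinity.
(** * Compact diagonal operators and almost anticliques *)

Section AlmostAnticlique.
Variables (R : realType) (H : completeNormedModType R[i]).
Variable dot : {dot H for (@Num.conj R[i])}.
Hypothesis dot_norm : forall x : H, `|x| ^+ 2 = dot x x.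
Local Notation C := R[i].

Lemma half_gt0 k : 0 < 2^-1 ^+ k :> C.
Proof. by rewrite exprn_gt0// invr_gt0. Qed.

Lemma sum_half m n : \sum_(m <= k < n) 2^-1 ^+ k <= 2^-1 ^+ m *+ 2 :> C.
Proof.
have [mn|nm] := leqP m n; last first.
  by rewrite big_geq ?(ltnW nm)// mulrn_wge0// ltW// half_gt0.
rewrite (@telescope_sumr_eq _ _ _ (fun k => - (2^-1 ^+ k *+ 2)))//.
  by rewrite opprK addrC gerDl oppr_le0 mulrn_wge0// ltW// half_gt0.
by move=> k _; rewrite exprS; field.
Qed.

Lemma half_small (e : C) : 0 < e -> exists N, 2^-1 ^+ N <= e.
Proof.
move=> e0; have e0' : 0 < complex.Re e.
  by rewrite -ltcR RRe_real ?gtr0_real.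
have h1 : `|2^-1 : R| < 1 by rewrite ltr_norml; apply/andP; split; lra.
have /cvgr0Pnorm_le/(_ _ e0')[N _ /(_ N (leqnn N))] := cvg_expr h1.
rewrite /= ger0_norm ?exprn_ge0 ?invr_ge0// => hN; exists N.
rewrite -[leRHS]RRe_real ?gtr0_real//.
by move: hN; rewrite -lecR rmorphXn fmorphV rmorph_nat.
Qed.

Section Cube.
Variable a : nat -> H.
Hypothesis a_on : orthonormal_sequence dot a.

Lemma norm_le_coef_sum (x : H) e :
  proj dot a x = x ->
  (forall m, \sum_(0 <= k < m) `|dot x (a k)| <= e) -> `|x| <= e.
Proof.
move=> xa xe; rewrite -xa; apply: (cvg_norm_le (proj_cvg dot_norm a_on x)).
apply: nearW => m; apply: le_trans (xe m); apply: le_trans (ler_norm_sum _ _ _) _.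
apply: ler_sum => k _; rewrite normrZ (unit_norm dot_norm) ?mulr1//.
by rewrite a_on eqxx.
Qed.

(** A Hilbert cube is compact: along an ultrafilter each coordinate converges,
    and the norm is controlled by the coordinates, uniformly in the tail. *)
Lemma compact_cube M :
  compact [set x | proj dot a x = x /\
                   forall n, `|dot x (a n)| <= M * 2^-1 ^+ n].
Proof.
rewrite compact_ultra => G GU GD.
have GF : ProperFilter G by exact: ultra_proper.
have M0 : 0 <= M.
  have [x [_ /(_ 0%N)]] := filter_ex GD.
  by rewrite expr0 mulr1; apply: le_trans.
have /choice[z zP] : forall n, exists z : C,
    (fun x => dot x (a n) : C^o) @ G --> (z : C^o).
  move=> n; apply/(cvg_ex (T := C^o)).
  apply: (@ultra_cvg_bounded _ _ G GU _ (M * 2^-1 ^+ n)).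
  by apply: filterS GD => x [_]; exact.
have z_le n : `|z n| <= M * 2^-1 ^+ n.
  by apply: (cvg_norm_le (zP n)); apply: filterS GD => x [].
have [s [sa s_coef]] : exists s, proj dot a s = s /\ forall n, dot s (a n) = z n.
  apply: (exists_of_coefs dot_norm a_on (M := M ^+ 2 * (2^-1 ^+ 0 *+ 2))) => n.
  apply: le_trans (ler_wpM2l (exprn_ge0 2 M0) (sum_half 0 n)).
  rewrite mulr_sumr; apply: ler_sum => k _.
  apply: (@le_trans _ _ ((M * 2^-1 ^+ k) ^+ 2)).
    by rewrite ler_pXn2r ?nnegrE ?mulr_ge0 ?(ltW (half_gt0 _)).
  rewrite exprMn ler_wpM2l ?exprn_ge0// expr2 ler_piMr ?(ltW (half_gt0 _))//.
  by rewrite exprn_ile1// ?invr_ge0// invf_le1 ?ler1n.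
exists s; split; first by split=> // n; rewrite s_coef.
apply/cvgrPdist_le => e e0.
(* The coordinates from [N] on contribute at most [e / 2] to the distance of two
   points of the cube; the finitely many earlier ones converge along [G]. *)
have [N NP] : exists N, M * 2^-1 ^+ N *+ 4 <= e / 2.
  have [|N NP] := @half_small (e / 2 / ((M + 1) *+ 4)).
    by rewrite !divr_gt0// mulrn_wgt0// ltr_wpDl.
  exists N; rewrite -mulrnAl; apply: (@le_trans _ _ ((M + 1) *+ 4 * 2^-1 ^+ N)).
    by rewrite ler_wpM2r ?(ltW (half_gt0 _))// lerMn2r lerDl ler01 orbT.
  by rewrite mulrC -ler_pdivlMr// mulrn_wgt0// ltr_wpDl.
have near_sum n e' : 0 < e' ->
    G [set x | \sum_(0 <= k < n) `|dot x (a k) - z k| <= e'].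
  elim: n e' => [|n IH] e' e'0.
    by apply: filterE => x; rewrite /= big_geq// ltW.
  have e'2 : 0 < e' / 2 by rewrite divr_gt0.
  have := zP n => /cvgrPdist_le/(_ _ e'2) Gn.
  apply: (@filterS _ G _ _ _ _ (filterI Gn (IH _ e'2))) => x [xn xsum].
  by rewrite /= big_nat_recr//= (splitr e') lerD// distrC.
have e2 : 0 < e / 2 by rewrite divr_gt0.
apply: (@filterS _ G _ _ _ _ (filterI GD (near_sum N _ e2))) => x [[xa x_le] xN].
rewrite distrC; apply: norm_le_coef_sum.
  have := proj_linear dot_norm a_on (-1) s x.
  by rewrite sa xa !scaleN1r addrC => ->; rewrite addrC.
move=> m; under eq_bigr do rewrite dotBl s_coef.
have [mN|/ltnW Nm] := leqP m N.
  apply: (@le_trans _ _ (e / 2)).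
    2: by rewrite ler_piMr ?(ltW e0)// invf_le1// ler1n.
  apply: le_trans xN; rewrite [leRHS](big_cat_nat (n := m))//= lerDl.
  by apply: sumr_ge0.
rewrite (big_cat_nat (n := N))//= (splitr e) lerD//; apply: le_trans NP.
apply: (@le_trans _ _ (\sum_(N <= k < m) (M * 2^-1 ^+ k) *+ 2)).
  apply: ler_sum => k _; apply: le_trans (ler_normB _ _) _.
  by rewrite mulr2n lerD.
rewrite sumrMnl -mulr_sumr (_ : 4 = 2 * 2)%N// mulrnA lerMn2r /=.
by rewrite -mulrnAr ler_wpM2l// sum_half.
Qed.


End Cube.

Lemma linear_combE a (A B : H -> H) x : (a *: A + B) x = a *: A x + B x.
Proof. by []. Qed.

Lemma bounded_linear_comb a (A B : H -> H) :
  bounded_operators A -> bounded_operators B -> bounded_operators (a *: A + B).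
Proof.
move=> Abd Bbd; split=> [b x y|].
  rewrite !linear_combE (bddP Abd) (bddP Bbd).
  by rewrite !scalerDr !scalerA [a * b]mulrC addrACA.
have [M M0 AM] := bdd_bound Abd; have [N N0 BN] := bdd_bound Bbd.
exists (`|a| * M + N) => x; rewrite linear_combE (le_trans (ler_normD _ _))//.
by rewrite mulrDl lerD// normrZ -mulrA ler_wpM2l.
Qed.

Lemma bounded_comp (A B : H -> H) :
  bounded_operators A -> bounded_operators B -> bounded_operators (A \o B).
Proof.
move=> Abd Bbd; split=> [b x y /=|]; first by rewrite (bddP Bbd) (bddP Abd).
have [M M0 AM] := bdd_bound Abd; have [N N0 BN] := bdd_bound Bbd.
exists (M * N) => x /=; apply: le_trans (AM _) _.
by rewrite -mulrA ler_wpM2l// ltW.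
Qed.

Lemma sum_fctE n (c : 'I_n -> C) (A : 'I_n -> H -> H) x :
  (\sum_i c i *: A i) x = \sum_i c i *: A i x.
Proof. by rewrite fct_sumE. Qed.

Lemma range_linear (P : H -> H) : bounded_operators P -> linear_set (range P).
Proof.
move=> Pbd; split; first by exists 0 => //; exact: bdd0.
by move=> a _ _ [x _ <-] [y _ <-]; exists (a *: x + y) => //; exact: bddP.
Qed.

Lemma projection_range (P : H -> H) x : projection dot P -> range P x -> P x = x.
Proof. by move=> [_ PP _] [y _ <-]; rewrite -[in RHS]PP. Qed.

(** The projection onto the closed span of vectors in the range of [P] absorbs
    [P] on both sides. *)
Lemma proj_range_comp (P : H -> H) t : projection dot P ->
  orthonormal_sequence dot t -> (forall k, range P (t k)) ->
  (forall x, P (proj dot t x) = proj dot t x) /\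
  (forall x, proj dot t (P x) = proj dot t x).
Proof.
move=> PP t_on Pt; have [Pbd _ Padj] := PP.
have Pproj x : P (proj dot t x) = proj dot t x.
  apply: (cvg_unique (@norm_hausdorff _ _)) (proj_cvg dot_norm t_on x).
  rewrite [X in X @ _](_ : _ = P \o (fun n => \sum_(0 <= k < n) dot x (t k) *: t k)).
    exact: (bdd_cvg Pbd (proj_cvg dot_norm t_on x)).
  apply/funext => n /=; rewrite (bdd_sum Pbd); apply: eq_bigr => k _.
  by rewrite (bddZ Pbd) (projection_range PP (Pt k)).
split=> // x; apply: (dot_ext (dot := dot)) => z.
have padj := proj_adjoint dot_norm t_on.
by rewrite !padj Padj Pproj.
Qed.

(** On the closed span of [t], an operator whose other matrix coefficients
    against [t n] vanish acts on the [n]-th coordinate by a scalar. *)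
Lemma diagonal_coef (A : H -> H) t x n :
  bounded_operators A -> orthonormal_sequence dot t ->
  (forall k, k != n -> dot (A (t k)) (t n) = 0) ->
  dot (A (proj dot t x)) (t n) = dot x (t n) * dot (A (t n)) (t n).
Proof.
move=> Abd t_on At.
apply: (lim_eventually (N := n.+1) (dot_cvgl dot_norm (y := t n)
  (bdd_cvg Abd (proj_cvg dot_norm t_on x)))) => m nm /=.
rewrite (bdd_sum Abd) dot_suml (@sum_nat_single _ _ _ _ n) => [|k kn].
  by rewrite nm (bddZ Abd) dotZl.
by rewrite (bddZ Abd) dotZl At// mulr0.
Qed.

(** If some infinite rank compression of [V] is finite dimensional, choosing
    within its range an orthonormal sequence that diagonalizes a basis of the
    compression makes every operator a scalar plus a diagonal operator with
    entries tending to zero. *)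
Lemma finite_dimensional_compression_almost_anticlique
    (V : set (H -> H)) (P : H -> H) :
  operator_system dot V -> projection dot P -> infinite_rank P ->
  finite_dimensional (compression P V) ->
  exists P', infinite_quantum_almost_anticlique dot V P'.
Proof.
move=> [Vbd _ _ Vadj] PP Pinf [d [e [Ve eP]]]; have [Pbd _ _] := PP.
have /choice[A AP] : forall i, exists A, V A /\ P \o A \o P = e i.
  by move=> i; have [A VA Ae] := Ve i; exists A.
have /choice[adj adjP] : forall B : H -> H, exists B' : H -> H,
    V B -> is_adjoint dot B B'.
  move=> B; have [/Vadj[B' _ BB']|nVB] := pselect (V B); first by exists B'.
  by exists B.
have [lambda lambdaP] := exists_state_at_infinity dot_norm (range_linear Pbd) Pinf.
pose Bs := [seq A i | i <- enum 'I_d].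
have ABs i : A i \in Bs by apply: map_f; rewrite mem_enum.
have [|t [t_on Pt t_off t_diag]] := diagonal_sequence (adj := adj) (Bs := Bs)
    lambdaP.
  by move=> _ /mapP[i _ ->]; have [VA _] := AP i; split; [exact: Vbd | exact: adjP].
have [Pp pP] := proj_range_comp PP t_on Pt.
pose p := proj dot t.
have [pbd pp padj] : projection dot p := proj_projection dot_norm t_on.
have compE B : V B -> exists c : 'I_d -> C,
    p \o B \o p = \sum_i c i *: (p \o A i \o p).
  move=> VB; have [|c cE] := eP (P \o B \o P); first by exists B.
  exists c; apply/funext => x; rewrite sum_fctE /=.
  have := congr1 (fun F : H -> H => p (F (p x))) cE.
  rewrite /= sum_fctE /p !Pp pP => ->.
  rewrite -/p (bdd_sum pbd); apply: eq_bigr => i _.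
  by rewrite (bddZ pbd) -(AP i).2 /p /= pP Pp.
exists p; split=> //; first exact: (proj_infinite_rank dot_norm t_on).
  exists d, (fun i => p \o A i \o p); split=> [i|_ [B VB <-]]; last exact: compE.
  by exists (A i) => //; exact: (AP i).1.
move=> _ [B VB <-]; have [c cE] := compE B VB.
pose mu := \sum_i c i * lambda (A i).
have Kbd : bounded_operators (- mu *: p + (p \o B \o p)).
  exact: (bounded_linear_comb _ pbd
    (bounded_comp (bounded_comp pbd (Vbd _ VB)) pbd)).
exists mu, (- mu *: p + (p \o B \o p)); split; last first.
  by rewrite addrA scaleNr subrr add0r.
split=> //; pose M := \sum_i `|c i|.
have := compact_precompact (@norm_hausdorff _ H) (compact_cube t_on (M := M)).
apply: precompact_subset => _ [x /= x1 <-]; set K := - mu *: p + (p \o B \o p).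
have KE y : K y = - mu *: p y + p (B (p y)) by [].
have ppE y : p (p y) = p y := congr1 (@^~ y) pp.
split=> [|n]; first by rewrite KE -/p (bddP pbd) !ppE.
have -> : dot (K x) (t n) =
    \sum_i c i * (dot (A i (t n)) (t n) - lambda (A i)) * dot x (t n).
  have := congr1 (fun F : H -> H => F x) cE; rewrite KE sum_fctE /= => ->.
  rewrite dotDl dotZl (proj_coef dot_norm t_on) /mu mulNr addrC dot_suml.
  rewrite mulr_suml -sumrB; apply: eq_bigr => i _.
  rewrite dotZl (proj_coef dot_norm t_on) (diagonal_coef _ (Vbd _ (AP i).1) t_on).
    by ring.
  by move=> k; exact: (t_off _ (ABs i)).
apply: le_trans (ler_norm_sum _ _ _) _; rewrite mulr_suml; apply: ler_sum => i _.
rewrite !normrM -mulrA ler_wpM2l//; apply: (@le_trans _ _ (2^-1 ^+ n * 1)).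
  apply: ler_pM => //; first exact: (t_diag _ (ABs i)).
  apply: le_trans (CauchySchwarz dot_norm _ _) _.
  by rewrite (unit_norm dot_norm (x := t n)) ?mulr1// t_on eqxx.
by rewrite mulr1.
Qed.


End AlmostAnticlique.
(** * Spaces of operators of bounded rank *)

Lemma exists_nonroot (C : numDomainType) (p : {poly C}) :
  p != 0 -> exists t, ~~ root p t.
Proof.
move=> p0; apply: contrapT => /forallNP pr.
have /(max_poly_roots p0) : all (root p) [seq k%:R | k <- iota 0 (size p)].
  by apply/allP => t _; have /negP := pr t; rewrite negbK.
rewrite size_map size_iota ltnn map_inj_uniq ?iota_uniq; first by move/(_ isT).
by move=> m n /eqP; rewrite eqr_nat => /eqP.
Qed.

(** The matrix [A + s *: B] is singular for finitely many [s] only: the inverse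
    of a nonzero such [s] is, up to sign, an eigenvalue of [invmx A *m B]. *)
Lemma exists_unitmx_perturbation (C : numFieldType) n (A B : 'M[C]_n) :
  A \in unitmx -> exists2 s, s != 0 & A + s *: B \in unitmx.
Proof.
move=> Aunit; pose g := invmx A *m B.
have [|t] := @exists_nonroot _ (char_poly g * 'X).
  by rewrite mulf_neq0 ?polyX_eq0// monic_neq0// char_poly_monic.
rewrite rootM rootX negb_or -eigenvalue_root_char negbK => /andP[gt t0].
exists (- t^-1); first by rewrite oppr_eq0 invr_eq0.
have {}gt : g - t%:M \in unitmx by rewrite -row_free_unit -kermx_eq0.
rewrite (_ : A + _ = - t^-1 *: (A *m (g - t%:M))).
  by rewrite unitmxZ ?unitmx_mul ?Aunit// unitfE oppr_eq0 invr_eq0.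
rewrite mulmxBr mulmxA mulmxV// mul1mx scalerBr mul_mx_scalar scalerA.
by rewrite mulNr mulVf// scaleN1r opprK addrC.
Qed.

Section BoundedRank.
Variables (R : realType) (H : completeNormedModType R[i]).
Variable dot : {dot H for (@Num.conj R[i])}.
Hypothesis dot_norm : forall x : H, `|x| ^+ 2 = dot x x.
Local Notation C := R[i].

(** The matrix of the form [<B x, y>] on two finite families. *)
Definition gram (B : H -> H) m n (x : 'I_m -> H) (y : 'I_n -> H) :
  'M[C]_(m, n) := \matrix_(i, j) dot (B (x i)) (y j).

Lemma gram_mul B m n p q (x : 'I_m -> H) (y : 'I_n -> H)
    (u : 'M_(p, m)) (v : 'M_(q, n)) : bounded_operators B ->
  u *m gram B x y *m (map_mx (@Num.conj C) v)^T =
  gram B (fun k => \sum_i u k i *: x i) (fun l => \sum_j v l j *: y j).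
Proof.
move=> Bbd; apply/matrixP => k l; rewrite [RHS]mxE dot_sumr mxE.
apply: eq_bigr => j _; rewrite dotZr !mxE mulrC; congr (_ * _).
rewrite (bdd_sum Bbd) dot_suml; apply: eq_bigr => i _.
by rewrite (bddZ Bbd) dotZl !mxE.
Qed.

(** A form that vanishes on the vectors of [T] orthogonal to [W] has rank at
    most twice the size of [W] on [T]: by polarization it vanishes on two
    subspaces, each of codimension at most the size of [W]. *)
Lemma gram_size_le (T : set H) B W j (x y : 'I_j -> H) :
  linear_set T -> bounded_operators B ->
  (forall z, T z -> orthogonal_to dot W z -> dot (B z) z = 0) ->
  (forall i, T (x i)) -> (forall i, T (y i)) ->
  gram B x y \in unitmx -> (j <= (size W).*2)%N.
Proof.
move=> TL Bbd Bdiag Tx Ty Munit; set M := gram B x y.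
have B0 z w : T z -> orthogonal_to dot W z -> T w -> orthogonal_to dot W w ->
    dot (B z) w = 0.
  move=> Tz zW Tw wW; have ortho := linear_set_orthogonal dot W TL.
  (* Polarization: expanding at [a = 1] and [a = 'i]. *)
  have quad a : dot (B (a *: z + w)) (a *: z + w) = 0.
    by have [] := ortho.2 a z w (conj Tz zW) (conj Tw wW); exact: Bdiag.
  have Bz := Bdiag _ Tz zW; have Bw := Bdiag _ Tw wW.
  have := quad 1; have := quad 'i.
  rewrite !(bddP Bbd) !dotDl !dotDr !dotZl !dotZr Bz Bw !mulr0 !addr0 !add0r.
  rewrite conjCi rmorph1 !mul1r mulNr => /eqP.
  rewrite subr_eq0 => /eqP /(mulfI (neq0Ci _)) -> /eqP.
  by rewrite -mulr2n mulrn_eq0 => /eqP.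
pose E (e : 'I_j -> H) : 'M[C]_(j, size W) :=
  \matrix_(i, k) dot (e i) (nth 0 W k).
have kerE (e : 'I_j -> H) p (u : 'M_(p, j)) k : u *m E e = 0 ->
    orthogonal_to dot W (\sum_i u k i *: e i).
  move=> uE w /(nthP 0)[l lW <-]; rewrite dot_suml.
  have := congr1 (fun A : 'M_(p, size W) => A k (Ordinal lW)) uE.
  rewrite mxE [X in _ = X -> _]mxE => uE0; rewrite -[RHS]uE0.
  by apply: eq_bigr => i _; rewrite dotZl !mxE.
have Kzero : kermx (E x) *m M *m (map_mx (@Num.conj C) (kermx (E y)))^T = 0.
  rewrite gram_mul//; apply/matrixP => k l; rewrite mxE [RHS]mxE; apply: B0.
  - exact: linear_set_sum.
  - by apply: kerE; exact: mulmx_ker.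
  - exact: linear_set_sum.
  - by apply: kerE; exact: mulmx_ker.
have := mulmx0_rank_max Kzero.
rewrite mxrank_tr mxrank_map mxrankMfree ?row_free_unit// !mxrank_ker.
move: (rank_leq_col (E x)) (rank_leq_col (E y)).
move: (\rank (E x) : nat) (\rank (E y) : nat) => r1 r2; move: (size W : nat) => s.
by rewrite -addnn; lia.
Qed.
(** The family [x] with [z] appended at the end. *)
Definition extend_family j (x : 'I_j -> H) (z : H) (i : 'I_(j + 1)%N) : H :=
  match fintype.split i with inl i' => x i' | inr _ => z end.

Lemma gram_extend B j (x y : 'I_j -> H) z w :
  gram B (extend_family x z) (extend_family y w) =
  block_mx (gram B x y) (\col_i dot (B (x i)) w)
           (\row_l dot (B z) (y l)) (dot (B z) w)%:M.
Proof.
apply/matrixP => i l; rewrite !mxE /extend_family.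
by case: fintype.split => i'; rewrite !mxE;
  case: fintype.split => l'; rewrite !mxE ?ord1.
Qed.

(** If the forms [<B x, y>] on [T], for [B] in a linear space [V0], each vanish
    on the orthogonal of boundedly many vectors, then they vanish together on
    the orthogonal of one finite list.  Indeed their ranks are bounded; on the
    kernels of a form of maximal rank, every other form vanishes, for otherwise
    adding a suitable multiple of it to the former would increase the rank. *)
Lemma bounded_rank_common_kernel (V0 : set (H -> H)) (T : set H)
    (adj : (H -> H) -> H -> H) (W : (H -> H) -> seq H) q :
  linear_set V0 -> linear_set T ->
  (forall B, V0 B -> bounded_operators B /\ is_adjoint dot B (adj B)) ->
  (forall B, V0 B -> (size (W B) <= q)%N) ->
  (forall B x, V0 B -> T x -> orthogonal_to dot (W B) x -> dot (B x) x = 0) ->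
  exists Z, forall B x y, V0 B -> (T `&` orthogonal_to dot Z) x ->
    (T `&` orthogonal_to dot Z) y -> dot (B x) y = 0.
Proof.
move=> V0L TL V0P Wq Wdiag.
pose P j := exists B (x y : 'I_j -> H), [/\ V0 B, forall i, T (x i),
  forall i, T (y i) & gram B x y \in unitmx].
have [j [[B0 [x [y [VB0 Tx Ty Bunit]]]] Pj1]] : exists j, P j /\ ~ P (j + 1)%N.
  apply: contrapT => /forallNP noj.
  have allP j : P j.
    elim: j => [|j IH].
      2: by rewrite -addn1; apply: contrapT => nP; exact: (noj j).
    exists 0, (fun=> 0), (fun=> 0); split=> //; first exact: V0L.1.
    + by move=> _; exact: TL.1.
    + by move=> _; exact: TL.1.
    + by rewrite unitmxE det_mx00 unitr1.
  have [B [x [y [VB Tx Ty Bunit]]]] := allP (q.*2).+1.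
  have := gram_size_le TL (V0P _ VB).1 (fun z => Wdiag B z VB) Tx Ty Bunit.
  by apply/negP; rewrite -ltnNge ltnS leq_double Wq.
pose Z := [seq adj B0 (y i) | i <- enum 'I_j] ++ [seq B0 (x i) | i <- enum 'I_j].
exists Z => B z w VB [Tz zZ] [Tw wZ].
have B0z i : dot (B0 z) (y i) = 0.
  rewrite (V0P _ VB0).2; apply: zZ; rewrite mem_cat.
  by apply/orP; left; apply: map_f; rewrite mem_enum.
have B0w i : dot (B0 (x i)) w = 0.
  apply: dot_eq0C; apply: wZ; rewrite mem_cat.
  by apply/orP; right; apply: map_f; rewrite mem_enum.
have maxP B' : V0 B' ->
    gram B' (extend_family x z) (extend_family y w) \notin unitmx.
  move=> VB'; apply/negP => unit'; apply: Pj1.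
  exists B', (extend_family x z), (extend_family y w); split=> // i.
    by rewrite /extend_family; case: fintype.split.
  by rewrite /extend_family; case: fintype.split.
have scalar_unit (a : C) : a != 0 -> a%:M \in @unitmx C 1.
  by move=> a0; rewrite unitmxE det_scalar1 unitfE.
have lower_unit (A : 'M[C]_j) v a : A \in unitmx -> a != 0 ->
    block_mx A 0 v (a%:M : 'M_1) \in unitmx.
  move=> Au a0; rewrite unitmxE det_lblock unitrM -!unitmxE Au.
  exact: scalar_unit.
have col0 : \col_i dot (B0 (x i)) w = 0.
  by apply/matrixP => i l; rewrite !mxE.
have row0 : \row_i dot (B0 z) (y i) = 0.
  by apply/matrixP => i l; rewrite !mxE.
have B0zw : dot (B0 z) w = 0.
  apply/eqP; apply: contraNT (maxP _ VB0) => B0zw.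
  by rewrite gram_extend col0 lower_unit.
apply/eqP; apply: contraT => Bzw.
pose N0 := block_mx (gram B0 x y) 0 (\row_i dot (B z) (y i)) (dot (B z) w)%:M.
pose N1 : 'M[C]_(j + 1) := block_mx (gram B x y) (\col_i dot (B (x i)) w) 0 0.
(* Dividing the last row of the Gram matrix of [B0 + s B] by [s] leaves a
   matrix which is still invertible at [s = 0]. *)
have [s s0 Ns] := @exists_unitmx_perturbation _ _ N0 N1 (lower_unit _ _ _ Bunit Bzw).
have VsB : V0 (s *: B + B0) by exact: V0L.2.
suff: gram (s *: B + B0) (extend_family x z) (extend_family y w) \in unitmx.
  by rewrite (negPf (maxP _ VsB)).
rewrite (_ : gram _ _ _ = block_mx 1%:M 0 0 s%:M *m (N0 + s *: N1)).
  by rewrite unitmx_mul Ns andbT lower_unit ?unitmx1.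
rewrite gram_extend scale_block_mx add_block_mx mulmx_block !mul1mx !mul0mx.
rewrite !scaler0 !addr0 !add0r !mul_scalar_mx.
by congr block_mx; apply/matrixP => i l; rewrite !mxE linear_combE dotDl dotZl
  ?B0z ?B0w ?B0zw ?addr0 ?mulr0 ?add0r 1?addrC// ?mulr_natr ?mulrnAr.
Qed.


End BoundedRank.
(** * A triangular system of operators *)

Section TriangularSystem.
Variables (R : realType) (H : completeNormedModType R[i]).
Variable dot : {dot H for (@Num.conj R[i])}.
Hypothesis dot_norm : forall x : H, `|x| ^+ 2 = dot x x.
Local Notation C := R[i].
Variables (V : set (H -> H)) (adj : (H -> H) -> H -> H).
Hypothesis V_linear : linear_set V.
Hypothesis V_bounded : V `<=` @bounded_operators R H.
Hypothesis adjP : forall B, V B -> is_adjoint dot B (adj B).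
Hypothesis V_infinite : forall P, projection dot P -> infinite_rank P ->
  ~ finite_dimensional (compression P V).

Lemma exists_orthonormal_sequence (T : set H) :
  linear_set T -> ~ finite_dimensional T ->
  exists t, orthonormal_sequence dot t /\ forall k, T (t k).
Proof.
move=> TL infT; have [lambda lambdaP] := exists_state_at_infinity dot_norm TL infT.
by have [//|t [t_on Tt _ _]] :=
  diagonal_sequence (adj := id) (Bs := [::]) lambdaP; exists t.
Qed.

(** Finitely many linear conditions on [B] in [V], and a bounded number of
    orthogonality conditions on [x] that may depend on [B], leave room for
    [<B x, x>] to be nonzero: otherwise the forms of a subspace of [V] of finite
    codimension would vanish together on an infinite dimensional subspace of
    [T], and [V] would have a finite dimensional compression. *)
Lemma exists_nonvanishing (T : set H) (fs : seq ((H -> H) -> C))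
    (W : (H -> H) -> seq H) q :
  linear_set T -> ~ finite_dimensional T ->
  (forall f, f \in fs -> linear_on V f) ->
  (forall B, (size (W B) <= q)%N) ->
  exists B x, [/\ V B, forall f, f \in fs -> f B = 0, T x,
    orthogonal_to dot (W B) x & dot (B x) x != 0].
Proof.
move=> TL infT fsL Wq; apply: contrapT => none.
pose V0 := V `&` [set B | forall f, f \in fs -> f B = 0].
have [|||||Z ZP] := @bounded_rank_common_kernel _ _ dot V0 T adj W q.
- exact: linear_setI_kers.
- exact: TL.
- by move=> B [VB _]; split; [exact: V_bounded | exact: adjP].
- by move=> B _; exact: Wq.
- move=> B x [VB fB] Tx xW; apply/eqP; apply: contra_notT none => Bx.
  by exists B, x.
have TZL := linear_set_orthogonal dot Z TL.
have [t [t_on Tt]] := exists_orthonormal_sequence TZL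
  (orthogonal_infinite (W := Z) TL infT).
pose p := proj dot t; pose S x n := \sum_(0 <= k < n) dot x (t k) *: t k.
have Sp x : S x @ \oo --> p x := proj_cvg dot_norm t_on x.
have TS x n : (T `&` orthogonal_to dot Z) (S x n).
  by rewrite /S big_mkord; apply: (linear_set_sum _ TZL) => k; exact: Tt.
have pP : projection dot p := proj_projection dot_norm t_on.
have [pbd _ _] := pP.
apply: (V_infinite pP (proj_infinite_rank dot_norm t_on)).
apply: (@finite_dimensional_kers _ _ _ V (fun B => p \o B \o p) fs) => //.
  move=> a A B; apply/funext => x /=.
  by rewrite linear_combE (bddD pbd) (bddZ pbd).
exists 0%N, (fun=> 0); split=> [[]//|_ [B VB <-]].
exists (fun=> 0); rewrite big_ord0; apply/funext => x /=.
apply: (dot_ext (dot := dot)) => y; rewrite dot0l.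
have Bbd : bounded_operators B by apply: V_bounded; exact: VB.1.
rewrite (proj_adjoint dot_norm t_on) -/p.
apply: (lim_eventually (N := 0)
  (dot_cvg dot_norm (bdd_cvg Bbd (Sp x)) (Sp y))) => n _.
exact: ZP.
Qed.

(** [B] is small on the vectors of [T] orthogonal to suitable finite lists; in
    other words, its compression to [T] is a compact form. *)
Definition vanishes_at_infinity (T : set H) (B : H -> H) :=
  forall e, 0 < e -> exists W, forall x, T x -> orthogonal_to dot W x ->
    `|dot (B x) x| <= e * dot x x.

(** The finite linear combinations of an orthonormal sequence: the vectors
    equal to all late enough partial sums of their expansion. *)
Definition finite_span (t : nat -> H) : set H :=
  [set x | exists N, forall n, (N <= n)%N ->
    x = \sum_(0 <= k < n) dot x (t k) *: t k].

Lemma linear_set_finite_span t : linear_set (finite_span t).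
Proof.
split; first by exists 0%N => n _; rewrite big1// => k _; rewrite dot0l scale0r.
move=> a x y [N xN] [M yM]; exists (maxn N M) => n; rewrite geq_max => /andP[Nn Mn].
rewrite {1}(xN n Nn) {1}(yM n Mn) scaler_sumr -big_split; apply: eq_bigr => k _ /=.
by rewrite dotDl dotZl scalerDl scalerA.
Qed.

Lemma finite_span_in t k : orthonormal_sequence dot t -> finite_span t (t k).
Proof.
move=> t_on; exists k.+1 => n kn; rewrite (@sum_nat_single _ _ _ _ k) => [|l lk].
  by rewrite kn t_on eqxx scale1r.
by rewrite t_on eq_sym (negPf lk) scale0r.
Qed.

Lemma finite_span_sub (T : set H) t :
  linear_set T -> (forall k, T (t k)) -> finite_span t `<=` T.
Proof.
move=> TL Tt x [N /(_ N (leqnn N)) ->]; rewrite big_mkord.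
exact: (linear_set_sum _ TL).
Qed.

Lemma diagonal_vanishes_at_infinity t B :
  bounded_operators B -> orthonormal_sequence dot t ->
  (forall k l, k != l -> dot (B (t k)) (t l) = 0) ->
  (forall k, `|dot (B (t k)) (t k)| <= 2^-1 ^+ k) ->
  vanishes_at_infinity (finite_span t) B.
Proof.
move=> Bbd t_on B_off B_diag e e0; have [N Ne] := half_small e0.
exists [seq t k | k <- iota 0 N] => x [n xn] xW; have {xn} xE := xn n (leqnn n).
have BxE : dot (B x) x =
    \sum_(0 <= k < n) `|dot x (t k)| ^+ 2 * dot (B (t k)) (t k).
  rewrite {1}xE (bdd_sum Bbd) dot_suml; apply: eq_big_nat => k kn.
  rewrite (bddZ Bbd) dotZl {2}xE dot_sumr (@sum_nat_single _ _ _ _ k) => [|l lk].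
    by rewrite kn dotZr mulrA normCK.
  by rewrite dotZr B_off ?mulr0// eq_sym.
have xxE : dot x x = \sum_(0 <= k < n) `|dot x (t k)| ^+ 2.
  by rewrite -dot_norm {1}xE (norm_sum_orthonormal dot_norm t_on).
rewrite BxE xxE mulr_sumr; apply: le_trans (ler_norm_sum _ _ _) _.
apply: ler_sum => k _; have [kN|Nk] := ltnP k N.
  by rewrite xW ?map_f ?mem_iota// normr0 expr0n !mul0r normr0 mulr0.
have d_le : `|dot (B (t k)) (t k)| <= e.
  apply: le_trans (le_trans (B_diag k) _) Ne.
  by rewrite ler_wiXn2l// ?invr_ge0// invf_le1// ler1n.
by rewrite normrM normrX normr_id mulrC ler_wpM2r ?exprn_ge0.
Qed.

(** Histories [(a_0, B_0), ..., (a_(n-1), B_(n-1))] that leave room for a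
    further step: the [B_k] are compact forms on some infinite dimensional
    subspace. *)
Definition admissible (s : seq (H * (H -> H))) :=
  (forall p, p \in s -> V p.2) /\
  exists T, [/\ linear_set T, ~ finite_dimensional T &
    forall p, p \in s -> vanishes_at_infinity T p.2].

(** The pair [x = (a, B)] continues the history [s]: [a] is a unit vector
    orthogonal to the earlier vectors, the earlier operators have small entry at
    [(a, a)] and zero entries between [a] and the earlier vectors, and along the
    earlier vectors and [a] the only nonzero entry of [B] is [dot (B a) a = 1]. *)
Definition extends (s : seq (H * (H -> H))) (x : H * (H -> H)) :=
  [/\ V x.2,
      dot x.1 x.1 = 1 /\ forall p, p \in s -> dot p.1 x.1 = 0,
      forall p q, p \in s -> q \in s ->
        dot (p.2 q.1) x.1 = 0 /\ dot (p.2 x.1) q.1 = 0,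
      forall p, p \in s -> `|dot (p.2 x.1) x.1| <= 2^-1 ^+ (size s).+1 &
      [/\ dot (x.2 x.1) x.1 = 1,
        forall p q, p \in s -> q \in s -> dot (x.2 p.1) q.1 = 0 &
        forall p, p \in s -> dot (x.2 p.1) x.1 = 0 /\ dot (x.2 x.1) p.1 = 0]].

Lemma admissible_extends s : admissible s ->
  exists x, admissible (rcons s x) /\ extends s x.
Proof.
move=> [sV [T [TL infT Tvan]]].
have /choice[Wp WpP] : forall p : H * (H -> H), exists W : seq H,
    p \in s -> forall x, T x -> orthogonal_to dot W x ->
    `|dot (p.2 x) x| <= 2^-1 ^+ (size s).+1 * dot x x.
  move=> p; have [ps|] := boolP (p \in s); last by exists [::].
  by have [W WP] := Tvan p ps _ (@half_gt0 R (size s).+1); exists W.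
pose W0 := [seq p.1 | p <- s] ++ [seq p.2 q.1 | p <- s, q <- s] ++
  [seq adj p.2 q.1 | p <- s, q <- s] ++ flatten [seq Wp p | p <- s].
pose T0 := T `&` orthogonal_to dot W0.
have T0L : linear_set T0 by exact: linear_set_orthogonal.
have infT0 : ~ finite_dimensional T0 by exact: orthogonal_infinite.
have [lambda lambdaP] := exists_state_at_infinity dot_norm T0L infT0.
(* Orthogonality to [W B] decouples [B] between the history and the new vector;
   its size is [2 * size s] whatever [B] is. *)
pose W (B : H -> H) := [seq B p.1 | p <- s] ++ [seq adj B p.1 | p <- s].
pose fs := lambda :: [seq (fun B : H -> H => dot (B p.1) q.1) | p <- s, q <- s].
have [f /predU1P[->|]|B|B [x [VB fB [Tx xW0] xW Bx]]] :=
    @exists_nonvanishing T0 fs W (size s + size s) T0L infT0.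
- exact: (linear_on_sub V_bounded lambdaP.1).
- by move=> /allpairsP[[p q] [ps qs ->]] a A B _ _; rewrite -dotZl -dotDl.
- by rewrite size_cat !size_map.
have Bbd := V_bounded VB.
have x0 : x != 0 by apply: contra_neq Bx => ->; rewrite (bdd0 Bbd) dot0l.
pose r := `|x|^-1; pose a := r *: x; pose c := (dot (B a) a)^-1.
pose B' := c *: B.
have B'E y : B' y = c *: B y by [].
have Ba0 : dot (B a) a != 0.
  by rewrite (bddZ Bbd) dotZl dotZr !mulf_neq0// ?conjC_eq0 /r invr_eq0 normr_eq0.
have VB' : V B' by exact: linear_setZ.
have lambdaB' : lambda B' = 0.
  rewrite /B' -[c *: B]addr0 lambdaP.1// ?(fB lambda (mem_head _ _)) ?mulr0 ?add0r.
    by apply: (linear_on0 V_linear); exact: (linear_on_sub V_bounded lambdaP.1).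
  exact: V_bounded V_linear.1.
have a1 : dot a a = 1 by exact: normalize.
have T0a : T0 a by exact: linear_setZ.
have [Ta aW0] := T0a.
have [|t [t_on T0t t_off t_diag]] := diagonal_sequence (adj := adj) (Bs := [:: B'])
    lambdaP.
  by move=> _ /predU1P[->|//]; split; [exact: V_bounded | exact: adjP].
exists (a, B'); split.
  split; first by move=> p; rewrite mem_rcons => /predU1P[->//|]; exact: sV.
  exists (finite_span t); split; first exact: linear_set_finite_span.
    by apply: (orthonormal_infinite t_on) => k; exact: finite_span_in.
  move=> p; rewrite mem_rcons => /predU1P[->|ps].
    apply: diagonal_vanishes_at_infinity => //=; first exact: V_bounded.
      by move=> k l; apply: t_off; exact: mem_head.
    by move=> k; have := t_diag B' (mem_head _ _) k; rewrite lambdaB' subr0.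
  move=> e e0; have [W1 W1P] := Tvan p ps e e0; exists W1 => y yt yW1.
  by apply: W1P => //; have [] := finite_span_sub T0L T0t yt.
have in1 p : p \in s -> dot p.1 a = 0.
  by move=> ps; apply: dot_eq0C; apply: aW0; rewrite mem_cat map_f.
split=> //=.
- move=> p q ps qs; split.
    apply: dot_eq0C; apply: aW0; rewrite !mem_cat.
    by apply/orP; right; apply/orP; left; exact: allpairs_f.
  rewrite (adjP (sV p ps)); apply: aW0; rewrite !mem_cat.
  by do 2 (apply/orP; right); apply/orP; left; exact: allpairs_f.
- move=> p ps; have := WpP p ps a Ta; rewrite a1 mulr1; apply => w wW.
  apply: aW0; rewrite !mem_cat; do 3 (apply/orP; right); apply/flattenP.
  by exists (Wp p) => //; exact: map_f.
- split=> [|p q ps qs|p ps]; first by rewrite B'E dotZl mulVf.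
    rewrite B'E dotZl (fB (fun B : H -> H => dot (B p.1) q.1)) ?mulr0//.
    rewrite in_cons; apply/orP; right.
    exact: (allpairs_f (fun p q => fun B : H -> H => dot (B p.1) q.1)).
  rewrite !B'E (bddZ Bbd) !dotZl dotZr; split.
    by rewrite (dot_eq0C (xW _ _)) ?mulr0// mem_cat map_f.
  rewrite (adjP VB) xW ?mulr0// mem_cat.
  by apply/orP; right; exact: (map_f (fun p => adj B p.1)).
Qed.

(** Operators [B n] in [V] that are diagonal along one orthonormal sequence,
    with a nearly triangular array of diagonal entries. *)
Lemma exists_triangular_system : ~ finite_dimensional [set: H] ->
  exists (a : nat -> H) (B : nat -> H -> H),
  [/\ orthonormal_sequence dot a,
      forall n, V (B n),
      forall n k l, k != l -> dot (B n (a k)) (a l) = 0,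
      forall n k, (k < n)%N -> dot (B n (a k)) (a k) = 0 &
      forall n, dot (B n (a n)) (a n) = 1 /\
        forall k, (n < k)%N -> `|dot (B n (a k)) (a k)| <= 2^-1 ^+ k.+1].
Proof.
move=> infH.
have [|f fP] := @sequential_choice _ admissible extends _ admissible_extends.
  split=> //; exists setT; split=> //; split=> //.
pose a n := (f n).1; pose B n := (f n).2.
have mem_hist k n : (k < n)%N -> f k \in mkseq f n.
  by move=> kn; apply: map_f; rewrite mem_iota.
exists a, B; split.
- move=> i j; have [ij|ji|->] := ltngtP i j; last by have [_ []] := fP j.
    by have [_ [_ ->]] := fP j; rewrite ?mem_hist.
  by apply: dot_eq0C; have [_ [_ ->]] := fP i; rewrite ?mem_hist.
- by move=> n; have [] := fP n.
- have up n k l : (k < l)%N ->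
      dot (B n (a k)) (a l) = 0 /\ dot (B n (a l)) (a k) = 0.
    move=> kl; have [nl|ln|->] := ltngtP n l.
    + by have [_ _ nP _ _] := fP l; apply: nP; exact: mem_hist.
    + have [_ _ _ _ [_ nP _]] := fP n.
      by split; apply: nP; apply: mem_hist => //; exact: (ltn_trans kl ln).
    + by have [_ _ _ _ [_ _ nP]] := fP l; apply: nP; exact: mem_hist.
  by move=> n k l; rewrite neq_ltn => /orP[kl|kl]; have [] := up n _ _ kl.
- move=> n k kn; have [_ _ _ _ [_ nP _]] := fP n.
  by apply: nP; exact: mem_hist.
- move=> n; split; first by have [_ _ _ _ []] := fP n.
  move=> k nk; have [_ _ _ kP _] := fP k.
  by have := kP _ (mem_hist n k nk); rewrite size_mkseq.
Qed.

End TriangularSystem.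
(** * Weak operator density by duality *)

(** A vector outside a linear set of row vectors is separated from it by a
    linear form. *)
Lemma separating_form (F : fieldType) n (X : set 'rV[F]_n) (t : 'rV_n) :
  linear_set X -> ~ X t ->
  exists c : 'cV_n, (forall x, X x -> x *m c = 0) /\ t *m c != 0.
Proof.
move=> XL Xt; pose P r := exists M : 'M[F]_(r, n),
  row_free M /\ forall i, X (row i M).
(* A maximal free family of vectors in [X]; by maximality its span contains [X]. *)
have [r [[M [Mfree XM]] Pr1]] : exists r, P r /\ ~ P r.+1.
  apply: contrapT => /forallNP noP.
  have allP r : P r.
    elim: r => [|r IH]; last by apply: contrapT => nP; exact: (noP r).
    by exists 0; split=> [|[]//]; rewrite /row_free mxrank0.
  have [M [/eqP Mn _]] := allP n.+1.
  by have := rank_leq_col M; rewrite Mn ltnn.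
have XsubM x : X x -> (x <= M)%MS.
  move=> Xx; apply: contrapT => /negP xM; apply: Pr1.
  have XxM (i : 'I_(1 + r)) : X (row i (col_mx x M)).
    have [j ->|j ->] := split_ordP i; last by rewrite rowKd.
    by rewrite rowKu (_ : row j x = x)//; apply/rowP => l; rewrite mxE ord1.
  exists (col_mx x M); split; last exact: XxM.
  have : (M < x + M)%MS by rewrite ltmxE addsmxSr addsmx_sub negb_and xM.
  move=> /rank_ltmx; rewrite addsmxE (eqP Mfree) => rlt.
  by rewrite /row_free eqn_leq rlt (rank_leq_row (col_mx x M)).
have tM : ~~ (t <= M)%MS.
  apply/negP => /submxP[u tE]; apply: Xt; rewrite tE mulmx_sum_row.
  exact: (linear_set_sum _ XL).
have : t *m cokermx M != 0 by rewrite -submxE.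
move=> /eqP/matrixP tc; have [k kP] : exists k, (t *m cokermx M) 0 k != 0.
  apply: contrapT => /forallNP k0; apply: tc => i k; rewrite ord1 [RHS]mxE.
  by apply/eqP; apply: contrapT => /negP; exact: k0.
exists (col k (cokermx M)); split=> [x /XsubM|].
  by rewrite submxE colE mulmxA => /eqP ->; rewrite mul0mx.
rewrite colE mulmxA -colE; apply: contra_neq kP => /matrixP/(_ 0 0).
by rewrite mxE => ->; rewrite mxE.
Qed.

Section Density.
Variables (R : realType) (H : completeNormedModType R[i]).
Variable dot : {dot H for (@Num.conj R[i])}.
Hypothesis dot_norm : forall x : H, `|x| ^+ 2 = dot x x.
Local Notation C := R[i].

(** An operator is in the weak operator closure of [S] if any finitely many of
    its matrix coefficients are those of a member of [S]. *)
Lemma weak_operator_closure (S : set (H -> H)) A :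
  (forall L : seq (H * H), exists2 B, S B &
    forall p, p \in L -> dot (B p.1) p.2 = dot (A p.1) p.2) ->
  closure (S : set (weak_operator dot)) A.
Proof.
move=> SA; rewrite closureEcvg.
pose match_on (L : seq (H * H)) := [set B | S B /\
  forall p, p \in L -> dot (B p.1) p.2 = dot (A p.1) p.2].
pose G := filter_from [set: seq (H * H)] match_on.
have GF : Filter G.
  apply: filter_fromT_filter; first by exists [::].
  move=> L1 L2; exists (L1 ++ L2) => B [SB BL].
  by split; split=> // p pL; apply: BL; rewrite mem_cat pL ?orbT.
have GP : ProperFilter G.
  by apply: filter_from_proper => L _; have [B SB BL] := SA L; exists B.
exists G => //; split; last first.
  by move=> U SU; exists [::] => // B [/SU].
have cvgA : matrix_coefficients dot @ G `=>` nbhs (matrix_coefficients dot A).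
  apply: (pointwise_cvgP _ _).2 => p; apply: cvg_near_cst.
  exists [:: p] => // B [_ Bp]; exact: (Bp p (mem_head _ _)).
move=> U /= [_ [[O Oop <-] OA sOU]].
have : nbhs (matrix_coefficients dot A) O by exact: open_nbhs_nbhs.
by move/cvgA => GO; exact: (@filterS _ G _ _ _ sOU GO).
Qed.

(** [P V P] is weakly dense in [P B(H) P] if every finite rank functional on the
    range of [P] that vanishes on [V] vanishes on all bounded operators: by
    duality in the finite dimensional space of values, finitely many matrix
    coefficients of a given operator can then be matched exactly within [V]. *)
Lemma weakly_dense_compression (V : set (H -> H)) (P : H -> H) :
  linear_set V -> projection dot P ->
  (forall n (c : 'I_n -> C) (x y : 'I_n -> H),
    (forall k, P (x k) = x k) -> (forall k, P (y k) = y k) ->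
    (forall B, V B -> \sum_k c k * dot (B (x k)) (y k) = 0) ->
    forall A, bounded_operators A -> \sum_k c k * dot (A (x k)) (y k) = 0) ->
  compression P (@bounded_operators R H) `<=`
    closure (compression P V : set (weak_operator dot)).
Proof.
move=> VL [Pbd PP Padj] VP _ [A Abd <-]; apply: weak_operator_closure => L.
have PPE z : P (P z) = P z := congr1 (@^~ z) PP.
pose x (k : 'I_(size L)) := P (nth (0, 0) L k).1.
pose y (k : 'I_(size L)) := P (nth (0, 0) L k).2.
pose coefs (B : H -> H) : 'rV[C]_(size L) := \row_k dot (B (x k)) (y k).
suff [B VB BA] : exists2 B, V B & coefs B = coefs A.
  exists (P \o B \o P) => [|p pL]; first by exists B.
  have [/= k kL <-] := nthP (0, 0) pL.
  have := congr1 (fun r : 'rV_(size L) => r 0 (Ordinal kL)) BA.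
  by rewrite !mxE /= !Padj.
have coefsL a B B' : coefs (a *: B + B') = a *: coefs B + coefs B'.
  by apply/rowP => k; rewrite !mxE linear_combE dotDl dotZl.
apply: contrapT => nA.
have [||c [Vc Ac]] := @separating_form _ _ (coefs @` V) (coefs A).
- split; first by exists 0; [exact: VL.1 | apply/rowP => k; rewrite !mxE dot0l].
  by move=> a _ _ [B VB <-] [B' VB' <-]; exists (a *: B + B') => //; exact: VL.2.
- by move=> [B VB BA]; apply: nA; exists B.
have coefsM B : (coefs B *m c) 0 0 = \sum_k c k 0 * dot (B (x k)) (y k).
  by rewrite mxE; apply: eq_bigr => k _; rewrite mxE mulrC.
apply/negP: Ac; rewrite negbK; apply/eqP/matrixP => i j.
rewrite !ord1 coefsM [RHS]mxE; apply: VP => //.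
- by move=> k; exact: PPE.
- by move=> k; exact: PPE.
- by move=> B VB; rewrite -coefsM Vc ?mxE//; exists B.
Qed.

End Density.
(** * Cliques from triangular systems *)

Section Clique.
Variables (R : realType) (H : completeNormedModType R[i]).
Variable dot : {dot H for (@Num.conj R[i])}.
Hypothesis dot_norm : forall x : H, `|x| ^+ 2 = dot x x.
Local Notation C := R[i].

Lemma cvg_sum_ord n I (F : set_system I) {FF : Filter F} (f : 'I_n -> I -> C^o)
    (l : 'I_n -> C^o) :
  (forall k, f k @ F --> l k) ->
  (fun i => \sum_k f k i : C^o) @ F --> (\sum_k l k : C^o).
Proof. by move=> fl; apply: cvg_big => //; exact: add_continuous. Qed.

Section Diagonal.
Variable a : nat -> H.
Hypothesis a_on : orthonormal_sequence dot a.

Lemma dot_diagonal A x y : bounded_operators A ->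
  (forall k l, k != l -> dot (A (a k)) (a l) = 0) ->
  proj dot a x = x -> proj dot a y = y ->
  (fun n => \sum_(0 <= k < n) dot (A (a k)) (a k) * (dot x (a k) * (dot y (a k))^*)
    : C^o) @ \oo --> (dot (A x) y : C^o).
Proof.
move=> Abd A_off xa ya.
rewrite (_ : (fun n => _) =
  fun n => dot (A (\sum_(0 <= k < n) dot x (a k) *: a k)) y : C^o).
  rewrite -{2}xa; apply: (dot_cvgl dot_norm).
  exact: (bdd_cvg Abd (proj_cvg dot_norm a_on x)).
apply/funext => n; rewrite (bdd_sum Abd) dot_suml; apply: eq_bigr => k _.
rewrite (bddZ Abd) dotZl mulrCA; congr (_ * _).
rewrite [RHS]dotC [dot (A (a k)) (a k)]dotC -rmorphM; congr (_^*).
rewrite mulrC -[in RHS]ya; symmetry.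
apply: (lim_eventually (N := k.+1) (dot_cvgl dot_norm (y := A (a k))
  (proj_cvg dot_norm a_on y))) => m km.
rewrite dot_suml (@sum_nat_single _ _ _ _ k) => [|l lk]; first by rewrite km dotZl.
by rewrite dotZl (dot_eq0C (A_off _ _ _)) ?mulr0// eq_sym.
Qed.


(** If a finite rank functional on the closed span of [a] vanishes at the
    operators of a triangular system, its diagonal [phi] with respect to [a]
    vanishes: the [n]-th equation expresses [phi n] as a combination of the later
    values with coefficients of total weight at most [1/2], so every bound for
    [phi] can be halved. *)
Lemma triangular_diagonal_eq0 (B : nat -> H -> H) m (c : 'I_m -> C)
    (x y : 'I_m -> H) :
  (forall n, bounded_operators (B n)) ->
  (forall n k l, k != l -> dot (B n (a k)) (a l) = 0) ->
  (forall n k, (k < n)%N -> dot (B n (a k)) (a k) = 0) ->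
  (forall n, dot (B n (a n)) (a n) = 1 /\
     forall k, (n < k)%N -> `|dot (B n (a k)) (a k)| <= 2^-1 ^+ k.+1) ->
  (forall k, proj dot a (x k) = x k) -> (forall k, proj dot a (y k) = y k) ->
  (forall n, \sum_k c k * dot (B n (x k)) (y k) = 0) ->
  forall n, \sum_k c k * (dot (x k) (a n) * (dot (y k) (a n))^*) = 0.
Proof.
move=> Bbd B_off B_low B_up xa ya cB.
pose phi n := \sum_k c k * (dot (x k) (a n) * (dot (y k) (a n))^*).
have phi_cvg n : (fun N => \sum_(0 <= j < N) dot (B n (a j)) (a j) * phi j : C^o)
    @ \oo --> (0 : C^o).
  rewrite -[X in _ --> X](cB n) (_ : (fun N => _) = fun N => \sum_k c k *
      (\sum_(0 <= j < N) dot (B n (a j)) (a j) *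
        (dot (x k) (a j) * (dot (y k) (a j))^*)) : C^o).
    apply: cvg_sum_ord => k; apply: cvgM; first exact: cvg_cst.
    by apply: dot_diagonal => //; exact: B_off.
  apply/funext => N; under [RHS]eq_bigr do rewrite mulr_sumr.
  rewrite exchange_big; apply: eq_bigr => j _; rewrite mulr_sumr.
  by apply: eq_bigr => k _; rewrite mulrCA.
pose M := \sum_k `|c k| * (`|x k| * `|y k|).
have M0 : 0 <= M by apply: sumr_ge0 => k _; rewrite !mulr_ge0.
have a1 j : `|a j| = 1 by apply: (unit_norm dot_norm); rewrite a_on eqxx.
have phi_le_half e : (forall n, `|phi n| <= e) -> forall n, `|phi n| <= e / 2.
  move=> phi_e n; have e0 : 0 <= e by apply: le_trans (phi_e n).
  rewrite -normrN -sub0r.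
  have diff_cvg : (fun N => \sum_(0 <= j < N) dot (B n (a j)) (a j) * phi j
      - phi n : C^o) @ \oo --> (0 - phi n : C^o).
    by apply: cvgB; [exact: phi_cvg | exact: cvg_cst].
  apply: (cvg_norm_le diff_cvg).
  exists n.+1 => // N /= nN.
  rewrite (big_cat_nat (n := n.+1))//= big_nat_recr//= (B_up n).1 mul1r.
  rewrite big_nat big1 ?add0r => [|j jn]; last by rewrite B_low// mul0r.
  rewrite addrAC subrr add0r; apply: le_trans (ler_norm_sum _ _ _) _.
  apply: (@le_trans _ _ (\sum_(n.+1 <= j < N) 2^-1 ^+ j * (e / 2))).
    apply: ler_sum_nat => j /andP[nj _]; rewrite normrM.
    apply: (@le_trans _ _ (2^-1 ^+ j.+1 * e)).
      by apply: ler_pM => //; exact: (B_up n).2.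
    by rewrite exprSr -mulrA [_^-1 * e]mulrC.
  rewrite -mulr_suml ler_piMl// ?divr_ge0//.
  apply: le_trans (sum_half _ _ _) _; rewrite exprS -mulrnAl -[_ *+ 2]mulr_natr.
  by rewrite mulVf ?pnatr_eq0// mul1r exprn_ile1// ?invr_ge0// invf_le1// ler1n.
have phi_le j n : `|phi n| <= M * 2^-1 ^+ j.
  elim: j n => [|j IH] n; last by rewrite exprSr mulrA; exact: phi_le_half.
  rewrite expr0 mulr1; apply: le_trans (ler_norm_sum _ _ _) _.
  apply: ler_sum => k _; rewrite !normrM norm_conjC ler_wpM2l// ler_pM//.
    by apply: le_trans (CauchySchwarz dot_norm _ _) _; rewrite a1 mulr1.
  by apply: le_trans (CauchySchwarz dot_norm _ _) _; rewrite a1 mulr1.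
move=> n; apply/eqP; rewrite -normr_eq0; apply: contraT => phi0.
have {}phi0 : 0 < `|phi n| by rewrite lt_def phi0 normr_ge0.
have [|N] := @half_small R (`|phi n| / 2 / (M + 1)).
  by rewrite !divr_gt0// ltr_wpDl.
rewrite ler_pdivlMr ?ltr_wpDl// => Nphi.
have : `|phi n| <= `|phi n| / 2.
  apply: le_trans (phi_le N n) (le_trans _ Nphi).
  by rewrite mulrC ler_wpM2l ?(ltW (half_gt0 _ _))// lerDl.
by rewrite ler_pdivlMr// mulr_natr mulr2n gerDl (lt_geF phi0).
Qed.

(** An enumeration of the triples [(p, q, s)], with repetitions (numbers that are
    no codes give [(0, 0, false)]); the coordinates [2 k] and [2 k + 1] are
    devoted to the [k]-th triple. *)
Definition triple (k : nat) : nat * nat * bool :=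
  odflt (0%N, 0%N, false) (unpickle k).

Lemma triple_surj u : exists k, triple k = u.
Proof. by exists (pickle u); rewrite /triple pickleK. Qed.

(** The relative phases [1] and ['i] needed for polarization. *)
Definition phase (s : bool) : C := if s then 'i else 1.

(** The [n]-th coordinate of the [i]-th vector of the clique, up to
    normalization.  If [triple k = (p, q, s)], only the [p]-th and [q]-th vectors
    have nonzero coordinates [2 k] and [2 k + 1].  These two coordinates form the
    pair [(1, 1)] for the [p]-th vector and [phase s * (1, -1)] for the [q]-th
    one, so that they do not contribute to the inner product (for [p = q] both
    pairs are added), times a scalar that makes the sequence square summable. *)
Definition coefficient (i n : nat) : C :=
  let: (p, q, s) := triple n./2 in
  2^-1 ^+ (n./2).*2.+1 * ((i == p)%:R + (-1) ^+ odd n * (phase s * (i == q)%:R)).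

Lemma coefficient_le i n : `|coefficient i n| <= 2^-1 ^+ n *+ 2.
Proof.
rewrite /coefficient; case: (triple _) => -[p q] s.
rewrite normrM normrX ger0_norm ?invr_ge0// -[leRHS]mulr_natr; apply: ler_pM => //.
- by rewrite exprn_ge0// invr_ge0.
- rewrite ler_wiXn2l ?invr_ge0// ?invf_le1// ?ler1n//.
  by rewrite -[leqLHS]odd_double_half -add1n leq_add2r leq_b1.
- have norm_bool (b : bool) : `|b%:R : C| <= 1.
    by case: b; rewrite ?normr1 ?normr0.
  apply: le_trans (ler_normD _ _) _; rewrite -[2]/(1 + 1); apply: lerD => //.
  rewrite !normrM normrX normrN1 expr1n mul1r /phase.
  by case: s; rewrite ?normCi ?normr1 mul1r.
Qed.

Lemma coefficient_square_summable i n :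
  \sum_(0 <= k < n) `|coefficient i k| ^+ 2 <= 8.
Proof.
apply: (@le_trans _ _ (\sum_(0 <= k < n) 2^-1 ^+ k *+ 4)).
  apply: ler_sum => k _; apply: (@le_trans _ _ ((2^-1 ^+ k *+ 2) ^+ 2)).
    rewrite ler_pXn2r ?nnegrE ?mulrn_wge0 ?(ltW (half_gt0 _ _))//.
    exact: coefficient_le.
  rewrite exprMn_n lerMn2r /= expr2 ler_piMr ?(ltW (half_gt0 _ _))//.
  by rewrite exprn_ile1 ?invr_ge0// invf_le1// ler1n.
rewrite sumrMnl; apply: (@le_trans _ _ ((2^-1 ^+ 0 *+ 2) *+ 4)).
  by rewrite lerMn2r /= sum_half.
by rewrite expr0 -mulrnA.
Qed.

Lemma coefficient_even i k p q s : triple k = (p, q, s) ->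
  coefficient i (2 * k) = 2^-1 ^+ k.*2.+1 * ((i == p)%:R + phase s * (i == q)%:R).
Proof.
move=> kE; rewrite /coefficient mul2n doubleK kE odd_double expr0.
by rewrite mul1r.
Qed.

Lemma coefficient_odd i k p q s : triple k = (p, q, s) ->
  coefficient i (2 * k).+1 =
  2^-1 ^+ k.*2.+1 * ((i == p)%:R - phase s * (i == q)%:R).
Proof.
move=> kE; rewrite /coefficient mul2n /= uphalf_double kE odd_double expr1.
by rewrite mulN1r.
Qed.

Lemma coefficient_orthogonal i j N : i != j ->
  \sum_(0 <= n < 2 * N) coefficient i n * (coefficient j n)^* = 0.
Proof.
move=> ij; elim: N => [|N IH]; first by rewrite muln0 big_geq.
rewrite mulnS add2n !big_nat_recr//= IH add0r.
case kE: (triple N) => [[p q] s].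
rewrite !(coefficient_even _ kE) !(coefficient_odd _ kE).
rewrite !(rmorphM, rmorphD, rmorphB, rmorph_nat) /=.
set t := 2^-1 ^+ _.
have ijp (r : nat) : (i == r)%:R * (j == r)%:R = 0 :> C.
  have [ir|_] := eqVneq i r; last by rewrite mul0r.
  by rewrite -ir eq_sym (negPf ij) mulr0.
transitivity (2 * (t * t^*) * ((i == p)%:R * (j == p)%:R +
    phase s * (phase s)^* * ((i == q)%:R * (j == q)%:R))); first by ring.
by rewrite !ijp mulr0 addr0 mulr0.
Qed.

(** There is an orthonormal sequence [e] in the closed span of [a] such that a
    finite rank functional on the closed span of [e] is determined by its
    diagonal with respect to [a]: the coordinates devoted to [(p, q, false)] and
    [(p, q, true)] recover the matrix coefficients at [(p, q)] and [(q, p)] by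
    polarization. *)
Lemma exists_polarizing_sequence : exists e : nat -> H,
  [/\ orthonormal_sequence dot e, forall i, proj dot a (e i) = e i &
    forall m (c : 'I_m -> C) (x y : 'I_m -> H),
    (forall k, proj dot e (x k) = x k) -> (forall k, proj dot e (y k) = y k) ->
    (forall n, \sum_k c k * (dot (x k) (a n) * (dot (y k) (a n))^*) = 0) ->
    forall p q, \sum_k c k * (dot (x k) (e p) * (dot (y k) (e q))^*) = 0].
Proof.
have /choice[f fP] : forall i, exists x, proj dot a x = x /\
    forall n, dot x (a n) = coefficient i n.
  move=> i; exact: (exists_of_coefs dot_norm a_on (coefficient_square_summable i)).
have fa i : proj dot a (f i) = f i := (fP i).1.
have f_coef i n : dot (f i) (a n) = coefficient i n := (fP i).2 n.
have f0 i : f i != 0.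
  have [k kE] := triple_surj (i, i, false).
  apply/eqP => fi; have := f_coef i (2 * k)%N.
  rewrite (coefficient_even _ kE) fi dot0l eqxx mulr1 /phase -mulr2n => /esym/eqP.
  by rewrite mulf_eq0 pnatr_eq0 orbF gt_eqF ?half_gt0.
pose e i := `|f i|^-1 *: f i.
have e_on : orthonormal_sequence dot e.
  move=> i j; have [<-|ij] := eqVneq i j; first exact: (normalize dot_norm (f0 i)).
  suff ff : dot (f i) (f j) = 0 by rewrite dotZl dotZr ff !mulr0.
  have h := dot_proj dot_norm a_on (f i) (f j).
  rewrite fa in h.
  have h2 := cvg_comp _ _ (@cvg_mulnl 2 isT) h.
  apply: (lim_eventually (N := 0) h2) => N _ /=.
  rewrite -[RHS](coefficient_orthogonal N ij); apply: eq_bigr => n _.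
  by rewrite f_coef [dot (a n) _]dotC f_coef.
exists e; split=> // [i|m c x y xe ye diag0 p q].
  have abd := proj_bounded dot_norm a_on.
  by rewrite /e (bddZ abd) fa.
pose r i := `|f i|^-1.
pose U z i := dot z (e i) * r i.
have coord z n : proj dot e z = z -> forall p' q' s, triple n./2 = (p', q', s) ->
    dot z (a n) = 2^-1 ^+ (n./2).*2.+1 *
      (U z p' + (-1) ^+ odd n * (phase s * U z q')).
  move=> ez p' q' s nE; rewrite -{1}ez.
  apply: (lim_eventually (N := (maxn p' q').+1) (dot_cvgl dot_norm (y := a n)
    (proj_cvg dot_norm e_on z))) => N; rewrite gtn_max => /andP[pN qN].
  rewrite dot_suml; pose t : C := 2^-1 ^+ (n./2).*2.+1.
  rewrite (eq_bigr (fun i => t * (U z i * (i == p')%:R) +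
      t * ((-1) ^+ odd n * phase s) * (U z i * (i == q')%:R))); last first.
    move=> i _; rewrite !dotZl f_coef /coefficient nE /U /r /t; ring.
  rewrite big_split -!mulr_sumr.
  rewrite (@sum_nat_single _ _ _ _ p') => [|i /negPf ->]; last by rewrite mulr0.
  rewrite (@sum_nat_single _ _ _ _ q') => [|i /negPf ->]; last by rewrite mulr0.
  by rewrite pN qN !eqxx !mulr1 mulrDr !mulrA.
pose G i j := \sum_k c k * (U (x k) i * (U (y k) j)^*).
have polar s : (phase s)^* * G p q + phase s * G q p = 0.
  have [k kE] := triple_surj (p, q, s).
  have kE0 : triple (2 * k)./2 = (p, q, s) by rewrite mul2n doubleK.
  have kE1 : triple (2 * k).+1./2 = (p, q, s) by rewrite mul2n /= uphalf_double.
  pose t : C := 2^-1 ^+ k.*2.+1.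
  have t0 : t != 0 by rewrite gt_eqF// half_gt0.
  have : 2 * (t * t^*) * ((phase s)^* * G p q + phase s * G q p) = 0.
    pose D n := \sum_k c k * (dot (x k) (a n) * (dot (y k) (a n))^*).
    transitivity (D (2 * k)%N - D (2 * k).+1); last by rewrite /D !diag0 subrr.
    rewrite /D -sumrB.
    rewrite mulrDr !mulrA !mulr_sumr -big_split; apply: eq_bigr => l _ /=.
    rewrite (coord (x l) _ (xe l) _ _ _ kE0) (coord (y l) _ (ye l) _ _ _ kE0).
    rewrite (coord (x l) _ (xe l) _ _ _ kE1) (coord (y l) _ (ye l) _ _ _ kE1).
    rewrite /= mul2n doubleK uphalf_double odd_double /= expr0 expr1 -/t.
    rewrite !(rmorphM, rmorphD, rmorphN, rmorph1); ring.
  by move/eqP; rewrite !mulf_eq0 pnatr_eq0 /= conjC_eq0 (negPf t0) => /eqP.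
have Gpq : G p q = 0.
  have := polar false; have := polar true; rewrite /phase conjCi rmorph1 !mul1r.
  rewrite mulNr addrC => /eqP; rewrite subr_eq0 => /eqP/(mulfI (neq0Ci _)) ->.
  by move/eqP; rewrite -mulr2n mulrn_eq0 => /eqP.
have r0 i : r i != 0 by rewrite invr_eq0 normr_eq0.
have : (r p * (r q)^*) * \sum_k c k * (dot (x k) (e p) * (dot (y k) (e q))^*) = 0.
  rewrite -[RHS]Gpq mulr_sumr; apply: eq_bigr => k _.
  by rewrite /U rmorphM; ring.
by move/eqP; rewrite mulf_eq0 mulf_eq0 conjC_eq0 !(negPf (r0 _)) => /eqP.
Qed.

End Diagonal.

Lemma triangular_system_clique (V : set (H -> H)) a (B : nat -> H -> H) :
  linear_set V -> V `<=` @bounded_operators R H ->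
  orthonormal_sequence dot a -> (forall n, V (B n)) ->
  (forall n k l, k != l -> dot (B n (a k)) (a l) = 0) ->
  (forall n k, (k < n)%N -> dot (B n (a k)) (a k) = 0) ->
  (forall n, dot (B n (a n)) (a n) = 1 /\
     forall k, (n < k)%N -> `|dot (B n (a k)) (a k)| <= 2^-1 ^+ k.+1) ->
  exists P, infinite_quantum_clique dot V P.
Proof.
move=> VL Vbd a_on VB B_off B_low B_up.
have [e [e_on ea polar]] := exists_polarizing_sequence a_on.
have eP := proj_projection dot_norm e_on.
exists (proj dot e); split=> //; first exact: (proj_infinite_rank dot_norm e_on).
apply: weakly_dense_compression => // m c x y xe ye cV A Abd.
have [ae _] : (forall z, proj dot a (proj dot e z) = proj dot e z) /\ _ :=
  proj_range_comp dot_norm (proj_projection dot_norm a_on) e_on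
    (fun i => ex_intro2 _ _ (e i) I (ea i)).
have xa k : proj dot a (x k) = x k by rewrite -xe ae.
have ya k : proj dot a (y k) = y k by rewrite -ye ae.
have diag0 := triangular_diagonal_eq0 a_on (fun n => Vbd _ (VB n)) B_off B_low B_up
  xa ya (fun n => cV _ (VB n)).
have {}polar := polar _ c x y xe ye diag0.
pose S z n := \sum_(0 <= k < n) dot z (e k) *: e k.
have S_cvg z : proj dot e z = z -> S z @ \oo --> z.
  by move=> ez; rewrite -{2}ez; exact: (proj_cvg dot_norm e_on).
have lim_c : (fun n => \sum_k c k * dot (A (S (x k) n)) (S (y k) n) : C^o) @ \oo -->
    (\sum_k c k * dot (A (x k)) (y k) : C^o).
  apply: cvg_sum_ord => k; apply: cvgM; first exact: cvg_cst.
  apply: (dot_cvg dot_norm); last exact: S_cvg.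
  exact: (bdd_cvg Abd (S_cvg _ (xe k))).
apply: (lim_eventually (N := 0) lim_c) => n _.
transitivity (\sum_(0 <= p < n) \sum_(0 <= q < n) dot (A (e p)) (e q) *
    \sum_k c k * (dot (x k) (e p) * (dot (y k) (e q))^*)); last first.
  by rewrite big1// => p _; rewrite big1// => q _; rewrite polar mulr0.
under [RHS]eq_bigr do under eq_bigr do rewrite mulr_sumr.
under [RHS]eq_bigr do rewrite exchange_big.
rewrite exchange_big; apply: eq_bigr => k _.
rewrite (bdd_sum Abd) dot_suml mulr_sumr; apply: eq_bigr => p _.
rewrite dot_sumr mulr_sumr; apply: eq_bigr => q _.
by rewrite (bddZ Abd) dotZl dotZr; ring.
Qed.

End Clique.
Local Open Scope complex_scope.

Theorem corollary1p5 (R : realType) (H : completeNormedModType R[i])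
    (dot : {dot H for (@Num.conj R[i])})
    (dot_norm : forall x : H, `|x| ^+ 2 = dot x x)
    (H_infinite : ~ finite_dimensional [set: H])
    (V : set (H -> H)) (V_system : operator_system dot V) :
  (exists P : H -> H, infinite_quantum_clique dot V P) \/
  (exists P : H -> H, infinite_quantum_almost_anticlique dot V P).
Proof.
have [V_bounded VI VL Vadj] := V_system.
have V_linear : linear_set V.
  split=> //; have := VL (-1) _ _ VI VI.
  by rewrite scaleN1r addNr.
have [[P [PP Pinf Pfd]]|none] := pselect (exists P, [/\ projection dot P,
    infinite_rank P & finite_dimensional (compression P V)]).
  by right; exact: (finite_dimensional_compression_almost_anticlique _ V_system PP).
left; have /choice[adj adjP] : forall B : H -> H, exists B' : H -> H,
    V B -> is_adjoint dot B B'.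
  move=> B; have [/Vadj[B' _ BB']|nVB] := pselect (V B); first by exists B'.
  by exists B.
have [|a [B [a_on VB B_off B_low B_up]]] := exists_triangular_system dot_norm
    V_linear V_bounded adjP _ H_infinite.
  by move=> P PP Pinf Pfd; apply: none; exists P.
exact: (triangular_system_clique dot_norm V_linear V_bounded a_on VB B_off B_low B_up).
Qed.
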